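(* Let $\gamma=(\mathbf A,\mathbf B,\nu,z,f,f'')$ be a $\mathbb Z$-nondegenerate Neumann-Zagier datum with $N$ tetrahedra, let $k$ be a positive integer, let $\zeta=e^{2\pi i/k}$, and let $\theta_i$ ($1\le i\le N$) be complex numbers with $\theta_i^k=z_i$. Let $F_k=\mathbb Q(z_1,\dots,z_N,\zeta)$, and let $$\tau_{\gamma,k}=\frac{1}{k^{N/2}\sqrt{\det(\mathbf A\Delta_{z''}+\mathbf B\Delta_z^{-1})\,z^{f''/k}z''^{-f/k}}}\ \prod_{i=1}^N D_k^*(\theta_i^{-1})^{1/k}\sum_{m\in(\mathbb Z/k\mathbb Z)^N}a_m(\theta)$$ be the level $k$ 1-loop invariant of $\gamma$. Then $$\tau_{\gamma,k}^{2k}\in F_k .$$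
   Context: **Neumann-Zagier datum.** Let $M$ be an oriented hyperbolic 3-manifold with one cusp (for instance a hyperbolic knot complement) and $\mathcal T$ an ideal triangulation of $M$ with $N$ tetrahedra. For a complex shape parameter $z\in\mathbb C\setminus\{0,1\}$ put $z'=(1-z)^{-1}$ and $z''=1-z^{-1}$ (so $zz'z''=-1$). Each oriented ideal tetrahedron has its three pairs of opposite edges labelled by $z_i,z_i',z_i''$ in the cyclic order given by the orientation; which pair of opposite edges carries the distinguished parameter $z_i$ is a choice made for each tetrahedron. A Neumann-Zagier datum of $\mathcal T$ is a tuple $\gamma=(\mathbf A,\mathbf B,\nu,z,f,f'')$ consisting of: (a) two $N\times N$ integer matrices $\mathbf A,\mathbf B$ and a vector $\nu\in\mathbb Z^N$ encoding the coefficients of Thurston's gluing equations of the triangulation ($N-1$ independent equations imposing trivial holonomy around edges, and one equation imposing parabolic holonomy around the cusp), after eliminating the $z_i'$. Explicitly, an edge equation $\sum_i (G_{i}Z_i+G'_{i}Z'_i+G''_{i}Z''_i)=2\pi i$ with $Z_i+Z_i'+Z_i''=i\pi$, where $G_i,G_i',G_i''$ count how many edges of the $i$-th tetrahedron labelled $z_i,z_i',z_i''$ are identified with the given edge, yields a row with entries $G_i-G_i'$ of $\mathbf A$, $G''_i-G'_i$ of $\mathbf B$, and entry $2-\sum_iG_i'$ of $\nu$; the cusp equation, with right-hand side $0$ instead of $2\pi i$, is treated in the same way. (b) an $N$-tuple $z=(z_1,\dots,z_N)$ with $z_i\in\mathbb C\setminus\{0,1\}$ the shape parameters, satisfying $\prod_i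 z_i^{\mathbf A_{ji}}(1-z_i^{-1})^{\mathbf B_{ji}}=(-1)^{\nu_j}$ for $j=1,\dots,N$ (written $z^{\mathbf A}z''^{\mathbf B}=(-1)^\nu$); here $z$ is the geometric solution. (c) two vectors $f,f''\in\mathbb Z^N$ with $\mathbf Af+\mathbf Bf''=\nu$ (a combinatorial flattening: $f$, $f''$ and $f'=1-f-f''$ label edges of tetrahedra so that the sum around any edge of the triangulation is $2$). It is a known fact (Neumann-Zagier) that $\mathbf A\mathbf B^T$ is symmetric and $(\mathbf A\ \mathbf B)$ has full rank; hence $\mathbf B^{-1}\mathbf A$ is symmetric when $\mathbf B$ is invertible. The datum is called $\mathbb Z$-nondegenerate if $\mathbf B$ is invertible over the integers. **Notation for the 1-loop invariant.** $\Delta_z=\mathrm{diag}(z_1,\dots,z_N)$ and $\Delta_{z''}=\mathrm{diag}(z_1'',\dots,z_N'')$. The cyclic quantum dilogarithm is $D_k^*(x)=\prod_{s=1}^{k-1}(1-\zeta^{-s}x)^s$. For $m\in(\mathbb Z/k\mathbb Z)^N$, $$a_m(\theta)=e^{-i\pi\,m\cdot\mathbf B^{-1}\mathbf Am}\;\zeta^{\frac12[m\cdot\mathbf B^{-1}\mathbf Am+m\cdot\mathbf B^{-1}\nu]}\prod_{i=1}^N\frac{\theta_i^{-(\mathbf B^{-1}\mathbf Am)_i}}{(\zeta\theta_i^{-1};\zeta)_{m_i}},$$ where $m$ is represented by an integer vector with nonnegative entries (for instance $0\le m_i<k$; the value is independent of the representative), $\zeta^{1/2}=e^{\pi i/k}$,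 and $(x;q)_n=\prod_{r=0}^{n-1}(1-q^rx)$. The notation $z^{f''/k}z''^{-f/k}$ means $\prod_i z_i^{f_i''/k}(z_i'')^{-f_i/k}$ (this factor is outside the determinant). The square root and the $k$-th roots involve choices, but $\tau_{\gamma,k}^{2k}$ does not depend on them once the $\theta_i$ are chosen: its prefactor is $k^{-Nk}\det(\mathbf A\Delta_{z''}+\mathbf B\Delta_z^{-1})^{-k}\prod_i z_i^{-f_i''}(z_i'')^{f_i}$ and the product of dilogarithms contributes $\prod_iD_k^*(\theta_i^{-1})^2$. It is understood that $\det(\mathbf A\Delta_{z''}+\mathbf B\Delta_z^{-1})\ne0$, so that $\tau_{\gamma,k}$ is defined. *)

(* Defs.v *)
From HB Require Import structures.
From mathcomp Require Import all_boot all_order all_algebra all_fingroup.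
From mathcomp Require Import complex.
From mathcomp Require Import reals trigo.

Set Implicit Arguments.
Unset Strict Implicit.
Unset Printing Implicit Defensive.

Import Order.TTheory GRing.Theory Num.Theory.
Local Open Scope ring_scope.

Definition v0 : 'I_4 := @Ordinal 4 0 isT.
Definition v1 : 'I_4 := @Ordinal 4 1 isT.
Definition v2 : 'I_4 := @Ordinal 4 2 isT.
Definition v3 : 'I_4 := @Ordinal 4 3 isT.

(* Face f of a tetrahedron is the face opposite to vertex f.  It is glued to
   the face [glue i f f] of the tetrahedron [nbr i f], each vertex a != f
   being sent to [glue i f a]. *)
Record gluing (N : nat) := Gluing {
  nbr : 'I_N -> 'I_4 -> 'I_N;
  glue : 'I_N -> 'I_4 -> 'S_4
}.

(* An ordered pair (a, b) with a != b in tetrahedron i is the edge ab of that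
   tetrahedron, oriented from a to b. *)
Definition oedge (N : nat) := ('I_N * ('I_4 * 'I_4))%type.

Section Triangulation.
Context (N : nat) (T : gluing N).

(* Vertex labels are taken compatible with the orientation of the tetrahedra
   (vertices 1, 2, 3 run counterclockwise when seen from vertex 0), so that a
   gluing reverses the orientation of the faces iff it is an odd permutation. *)
Definition oriented_gluing : Prop := forall i f,
  let j := nbr T i f in let s := glue T i f in
  [/\ nbr T j (s f) = i, glue T j (s f) = (s^-1)%g,
      (j, s f) != (i, f) & odd_perm s].

Definition edge_step : rel (oedge N) := fun x y =>
  [exists f : 'I_4, [&& f != x.2.1, f != x.2.2 &
    y == (nbr T x.1 f, (glue T x.1 f x.2.1, glue T x.1 f x.2.2))]].

Definition same_oedge : rel (oedge N) := connect edge_step.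

(* (i, v) is the triangle cut off tetrahedron i by a small horosphere at v. *)
Definition link_step : rel ('I_N * 'I_4) := fun x y =>
  [exists f : 'I_4, (f != x.2) && (y == (nbr T x.1 f, glue T x.1 f x.2))].

(* The oriented ideal triangulations of oriented manifolds with one torus cusp:
   no edge is glued to itself reversed, the 4N triangles form one connected
   closed oriented surface, and it has Euler characteristic 0.  It has 4N
   triangles, 6N sides and one vertex for every oriented edge class, so the
   last condition says that there are 2N oriented edge classes. *)
Definition one_cusped_triangulation : Prop :=
  [/\ oriented_gluing,
      forall i a b, a != b -> ~~ same_oedge (i, (a, b)) (i, (b, a)),
      forall x y, connect link_step x y &
      n_comp edge_step [pred x : oedge N | x.2.1 != x.2.2] = (2 * N)%N].

(* A turn (i, p) is an arc, in the horospherical triangle of tetrahedron i at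
   the vertex p 0, around the corner where the edge (p 0)(p 1) ends; it enters
   through the face p 3 and leaves through the face p 2.  It goes around the
   corner counterclockwise, as seen from the cusp, iff p is even. *)
Definition turn := ('I_N * 'S_4)%type.

Definition follows (x y : turn) : bool :=
  let s := glue T x.1 (x.2 v2) in
  [&& y.1 == nbr T x.1 (x.2 v2), y.2 v0 == s (x.2 v0) &
      y.2 v3 == s (x.2 v2)].

Definition closed_curve n (c : n.-tuple turn) : Prop :=
  forall k : 'I_n, follows (tnth c k) (tnth c (ordS k)).

Section Embedded.
Context (n : nat) (c : n.-tuple turn) (pos : 'I_n -> rat).

(* [pos k] is the position at which the k-th turn is entered: the fraction of
   the length of the side, from its left to its right end in the direction of
   travel.  [corner_dist k u] is the distance between the corner of the k-th
   turn and the point where this turn crosses the face u. *)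
Definition corner_dist (k : 'I_n) (u : 'I_4) : rat :=
  let p := (tnth c k).2 in
  let x := if u == p v3 then pos k else pos (ordS k) in
  if odd_perm p then 1 - x else x.

Definition disjoint_turns (k l : 'I_n) : Prop :=
  let p := (tnth c k).2 in let r := (tnth c l).2 in
  if p v1 == r v1 then
    is_true (0 < (corner_dist k (p v2) - corner_dist l (p v2)) *
                 (corner_dist k (p v3) - corner_dist l (p v3)))
  else forall u, u \notin [:: p v0; p v1; r v1] ->
    corner_dist k u + corner_dist l u < 1.

Definition embedded_at : Prop :=
  (forall k, 0 < pos k < 1) /\
  (forall k l, k != l -> (tnth c k).1 = (tnth c l).1 ->
     (tnth c k).2 v0 = (tnth c l).2 v0 -> disjoint_turns k l).

End Embedded.

Definition simple_closed_curve n (c : n.-tuple turn) : Prop :=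
  [/\ (0 < n)%N, closed_curve c & exists pos, embedded_at c pos].

Definition path_end (i : 'I_N) (w : seq 'I_4) : 'I_N := foldl (nbr T) i w.

(* The next turn around the same edge. *)
Definition pivot (x : turn) : turn :=
  (nbr T x.1 (x.2 v2), (tperm v2 v3 * x.2 * glue T x.1 (x.2 v2))%g).

(* A word w of faces is the path which starts in the tetrahedron i and crosses
   these faces successively.  Homotopies in the manifold are generated by
   backtracking and by the loops around edges. *)
Inductive homotopic : 'I_N -> seq 'I_4 -> seq 'I_4 -> Prop :=
| Homot_refl i w : homotopic i w w
| Homot_sym i w w' : homotopic i w w' -> homotopic i w' w
| Homot_trans i w1 w2 w3 :
    homotopic i w1 w2 -> homotopic i w2 w3 -> homotopic i w1 w3
| Homot_cat i w1 w w' w2 : homotopic (path_end i w1) w w' ->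
    homotopic i (w1 ++ w ++ w2) (w1 ++ w' ++ w2)
| Homot_back i f : homotopic i [:: f; glue T i f f] [::]
| Homot_edge (x : turn) m : iter m pivot x = x ->
    homotopic x.1 [seq y.2 v2 | y : turn <- traject pivot x m] [::].

(* q i is the pair of opposite edges of tetrahedron i carrying z_i: 01|23 for
   0, 02|13 for 1, 03|12 for 2.  Labels 0, 1, 2 stand for z, z', z''. *)
Context (q : 'I_N -> 'Z_3).

Definition opposite_pair (a b : 'I_4) : 'Z_3 :=
  inZp (if (a == v0) || (b == v0) then (a + b).-1 else (5 - (a + b)))%N.

Definition label (i : 'I_N) (a b : 'I_4) : 'Z_3 := opposite_pair a b - q i.

Definition edge_coef (e : oedge N) (i : 'I_N) (t : 'Z_3) : int :=
  #|[set ab : 'I_4 * 'I_4 | [&& (ab.1 < ab.2)%N, label i ab.1 ab.2 == t &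
      same_oedge (i, ab) e || same_oedge (i, (ab.2, ab.1)) e]]|%:Z.

Definition curve_coef n (c : n.-tuple turn) (i : 'I_N) (t : 'Z_3) : int :=
  \sum_(x <- c | (x.1 == i) && (label i (x.2 v0) (x.2 v1) == t))
     (-1) ^+ odd_perm x.2.

Definition is_row (A B : 'M[int]_N) (nu : 'cV[int]_N) (j : 'I_N)
    (G : 'I_N -> 'Z_3 -> int) (rhs : int) : Prop :=
  [/\ forall i, A j i = G i 0 - G i 1,
      forall i, B j i = G i 2 - G i 1 &
      nu j 0 = rhs - \sum_i G i 1].

(* Row jc is the cusp equation and the other rows are edge equations.  Row
   freeness says that the N - 1 edge equations are independent and that the
   curve is not homotopically trivial in the cusp torus. *)
Definition gluing_matrices (A B : 'M[int]_N) (nu : 'cV[int]_N) : Prop :=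
  row_free (map_mx (intr : int -> rat) (row_mx A B)) /\
  exists (jc : 'I_N) (e : 'I_N -> oedge N) (n : nat) (c : n.-tuple turn),
  [/\ simple_closed_curve c,
      is_row A B nu jc (curve_coef c) 0 &
      forall j, j != jc -> (e j).2.1 != (e j).2.2 /\
        is_row A B nu j (edge_coef (e j)) 2].

Section Geometric.
Context (R : realType).
Local Notation C := (complex R).
Implicit Types (z : 'I_N -> C).

Definition shape (x : C) (t : 'Z_3) : C :=
  if t == 0 then x else if t == 1 then (1 - x)^-1 else 1 - x^-1.

(* Homogeneous coordinates of the vertices of tetrahedron i when they are put
   at infinity, 0, 1 and the shape parameter of the edge 01. *)
Definition vertex_pos z (i : 'I_N) (a : 'I_4) : 'cV[C]_2 :=
  if a == v0 then \col_r (r == 0)%:R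
  else \col_r (if r == 0 then
                 (if a == v1 then 0 else if a == v2 then 1
                  else shape (z i) (label i v0 v1))
               else 1).

Definition face_map z (i : 'I_N) (f : 'I_4) (g : 'M[C]_2) : Prop :=
  g \in unitmx /\ forall a, a != f -> exists2 l : C, l != 0 &
    g *m vertex_pos z i a = l *: vertex_pos z (nbr T i f) (glue T i f a).

(* g represents in PGL_2(C) the holonomy along w, which is determined by z. *)
Fixpoint holonomy z (i : 'I_N) (w : seq 'I_4) (g : 'M[C]_2) : Prop :=
  match w with
  | [::] => exists2 l : C, l != 0 & g = l%:M
  | f :: w' => exists g1 g2, [/\ face_map z i f g1,
      holonomy z (nbr T i f) w' g2 & g = g2 *m g1]
  end.

Definition loop_holonomy z (i : 'I_N) (w : seq 'I_4) (g : 'M[C]_2) : Prop :=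
  path_end i w = i /\ holonomy z i w g.

Definition discrete_faithful z (i : 'I_N) : Prop :=
  exists2 eps : C, 0 < eps & forall w g, loop_holonomy z i w g -> \det g = 1 ->
    (forall a b, `|g a b - (1%:M : 'M[C]_2) a b| < eps) -> homotopic i w [::].

(* The action of PGL_2(C) on the upper half space {(x, t) | t > 0}. *)
Definition h3_denom (g : 'M[C]_2) (x t : C) : C :=
  `|g 1 0 * x + g 1 1| ^+ 2 + `|g 1 0| ^+ 2 * t ^+ 2.
Definition h3_x (g : 'M[C]_2) (x t : C) : C :=
  ((g 0 0 * x + g 0 1) * Num.conj (g 1 0 * x + g 1 1)
     + g 0 0 * Num.conj (g 1 0) * t ^+ 2) / h3_denom g x t.
Definition h3_t (g : 'M[C]_2) (x t : C) : C := `|\det g| * t / h3_denom g x t.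

(* Finite covolume: as the unique cusp is at infinity, this means that the
   translates of some Siegel set {|x| <= r, t >= 1/r} cover the half space. *)
Definition finite_covolume z (i : 'I_N) : Prop :=
  exists2 r : C, 0 < r & forall x t : C, 0 < t ->
    exists w g, [/\ loop_holonomy z i w g,
      `|h3_x g x t| <= r & r^-1 <= h3_t g x t].

(* Orientation (this excludes the complex conjugate of the geometric solution):
   for side lengths len i v f of the horospherical triangles of a horospherical
   torus, the sum of the signed areas of these triangles is positive.  A triangle
   with a side of length l and shape parameter w at one end of it has signed
   area l^2 Im(w) / 2; every triangle is counted three times in the sum. *)
Definition positively_oriented z : Prop :=
  exists len : 'I_N -> 'I_4 -> 'I_4 -> C,
  [/\ forall i v f, v != f -> 0 < len i v f,
      forall i v f, v != f ->
        len i v f = len (nbr T i f) (glue T i f v) (glue T i f f),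
      forall i (p : 'S_4), ~~ odd_perm p ->
        len i (p v0) (p v2) =
          `|shape (z i) (label i (p v0) (p v1))| * len i (p v0) (p v3) &
      0 < \sum_i \sum_(p : 'S_4 | ~~ odd_perm p)
            len i (p v0) (p v3) ^+ 2 *
              'Im (shape (z i) (label i (p v0) (p v1)))].

(* z is the geometric solution: its holonomy is an isomorphism from the
   fundamental group onto a lattice of PGL_2(C), compatibly with orientations.
   In particular the manifold is hyperbolic. *)
Definition geometric_solution z : Prop :=
  (forall i, discrete_faithful z i /\ finite_covolume z i) /\
  positively_oriented z.

End Geometric.
End Triangulation.

Record NZ_tuple (R : realType) (N : nat) := NZTuple {
  nzA : 'M[int]_N;
  nzB : 'M[int]_N;
  nz_nu : 'cV[int]_N;
  nz_z : 'I_N -> complex R;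
  nz_f : 'cV[int]_N;
  nz_f'' : 'cV[int]_N
}.

Section OneLoop.
Context (R : realType) (N : nat).
Local Notation C := (complex R).
Implicit Types (gam : NZ_tuple R N) (k : nat) (theta : 'I_N -> C).

Definition nz_z'' gam (i : 'I_N) : C := 1 - (nz_z gam i)^-1.

Definition NZ_datum (T : gluing N) gam : Prop :=
  exists q : 'I_N -> 'Z_3,
  [/\ gluing_matrices T q (nzA gam) (nzB gam) (nz_nu gam),
      forall i, nz_z gam i != 0 /\ nz_z gam i != 1,
      geometric_solution T q (nz_z gam),
      forall j, \prod_i (nz_z gam i ^ nzA gam j i * nz_z'' gam i ^ nzB gam j i)
                = (-1) ^ nz_nu gam j 0 &
      nzA gam *m nz_f gam + nzB gam *m nz_f'' gam = nz_nu gam].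

Definition Z_nondegenerate gam : Prop := nzB gam \in unitmx.

Definition expi (x : R) : C := Complex (cos x) (sin x).

Definition zeta k : C := expi (2 * pi / k%:R).

Definition Dstar k (x : C) : C :=
  \prod_(1 <= s < k) (1 - zeta k ^- s * x) ^+ s.

Definition qpoch (x y : C) (n : nat) : C := \prod_(0 <= r < n) (1 - y ^+ r * x).

Definition a_coef gam k theta (m : 'I_N -> nat) : C :=
  let mc : 'cV[int]_N := \col_i (m i)%:Z in
  let Qm := invmx (nzB gam) *m nzA gam *m mc in
  let mQm : int := (mc^T *m Qm) 0 0 in
  let mnu : int := (mc^T *m (invmx (nzB gam) *m nz_nu gam)) 0 0 in
  expi (- (pi * mQm%:~R)) * expi (pi / k%:R) ^ (mQm + mnu) *
  \prod_i (theta i ^ (- Qm i 0) / qpoch (zeta k / theta i) (zeta k) (m i)).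

Definition one_loop_det gam : C :=
  \det (map_mx intr (nzA gam) *m diag_mx (\row_i nz_z'' gam i) +
        map_mx intr (nzB gam) *m diag_mx (\row_i (nz_z gam i)^-1)).

(* tau is a value of the level k 1-loop invariant, for some choice of the
   square root s, of k-th roots u, u'' of the factors of z^f'' and z''^(-f),
   and of k-th roots d of the quantum dilogarithms. *)
Definition one_loop_value gam k theta (tau : C) : Prop :=
  exists (s : C) (u u'' d : 'I_N -> C),
  [/\ forall i, u i ^+ k = nz_z gam i ^ nz_f'' gam i 0,
      forall i, u'' i ^+ k = nz_z'' gam i ^ (- nz_f gam i 0),
      forall i, d i ^+ k = Dstar k (theta i)^-1,
      s ^+ 2 = one_loop_det gam * \prod_i (u i * u'' i) &
      tau = (sqrtC k%:R ^+ N * s)^-1 * \prod_i d i *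
            \sum_(m : {ffun 'I_N -> 'I_k}) a_coef gam k theta (fun i => m i)].

(* The subfield generated by S. *)
Definition subfield_gen (S : C -> Prop) (x : C) : Prop :=
  forall K : {pred C}, divring_closed K -> (forall y, S y -> y \in K) -> x \in K.

Definition F_field gam k : C -> Prop :=
  subfield_gen (fun y => y = zeta k \/ exists i, y = nz_z gam i).

End OneLoop.

(* Main.v *)
(** Put [Q = B^-1 A] and let [S theta] be the state sum. Replacing [theta_i] by
    [zeta^-1 theta_i] amounts to shifting the summation index by the i-th unit
    vector, up to a factor whose 2k-th power is, by the gluing equations, undone
    by the quasi-periodicity of [D_k^*]. Hence [prod_i D_k^*(theta_i^-1)^2 S^(2k)]
    is invariant under all rotations of the [theta_i] by k-th roots of unity. It
    is also a Laurent polynomial in the [theta_i], so averaging it over these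
    rotations leaves a Laurent polynomial in the [z_i = theta_i^k]. Its
    coefficients lie in [Q(z, zeta)] and not only in [Q(z, zeta^(1/2))], because
    [m.Qm + m.B^-1 nu] is always even.

    The last fact and the symmetry of [Q] come from two combinatorial properties
    of the gluing equations. The matrix [A B^T] is symmetric: in the
    Neumann-Zagier pairing of an edge with a curve, every turn of the curve
    contributes the difference of a height function between the two sides of a
    horospherical triangle that it crosses, and these differences telescope.
    Moreover [nu_j = (A B^T)_jj] modulo 2: modulo 2 the difference counts, in all
    tetrahedra, the pairs of occurrences at non-opposite edges; such a pair of
    edges spans a unique face, and every face is seen from two sides. *)

From HB Require Import structures.
Require Import Defs.
From mathcomp Require Import all_boot all_order all_algebra all_fingroup.
From mathcomp Require Import complex.
From mathcomp Require Import reals trigo.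
From mathcomp Require Import boolp.
From mathcomp Require Import ring lra zify.

Set Implicit Arguments.
Unset Strict Implicit.
Unset Printing Implicit Defensive.

Import Order.TTheory GRing.Theory Num.Theory.
Local Open Scope ring_scope.

(** * Permutations of the vertices of a tetrahedron *)

Lemma ord4_ind (P : 'I_4 -> Prop) :
  P v0 -> P v1 -> P v2 -> P v3 -> forall a, P a.
Proof.
move=> P0 P1 P2 P3 [[|[|[|[|//]]]] i].
- by rewrite (_ : Ordinal i = v0) //; apply: val_inj.
- by rewrite (_ : Ordinal i = v1) //; apply: val_inj.
- by rewrite (_ : Ordinal i = v2) //; apply: val_inj.
- by rewrite (_ : Ordinal i = v3) //; apply: val_inj.
Qed.

Ltac ord4_cases := elim/ord4_ind; elim/ord4_ind=> //; elim/ord4_ind=> //;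
  elim/ord4_ind=> //.

Lemma big_ord4 (S : nmodType) (F : 'I_4 -> S) :
  \sum_a F a = F v0 + (F v1 + (F v2 + F v3)).
Proof.
rewrite !big_ord_recl big_ord0 addr0.
by congr (F _ + (F _ + (F _ + F _))); apply: val_inj.
Qed.

Lemma perm4_uniq (p : 'S_4) : uniq [:: p v0; p v1; p v2; p v3].
Proof. by rewrite /= !inE !(inj_eq perm_inj). Qed.

Lemma ord4_other (a b c d x : 'I_4) : uniq [:: a; b; c; d] ->
  x != a -> x != c -> x = b \/ x = d.
Proof.
by move: a b c d; ord4_cases=> _; elim/ord4_ind: x; auto.
Qed.

Lemma opposite_pairC a b : opposite_pair a b = opposite_pair b a.
Proof. by rewrite /opposite_pair orbC [(a + b)%N]addnC. Qed.

Ltac eval_ifs := repeat match goal with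
  |- context [if ?b then _ else _] =>
    first [rewrite (_ : b = true :> bool); last reflexivity
          |rewrite (_ : b = false :> bool); last reflexivity]
  end; cbv iota.

(** Permutations of the vertices act on the three pairs of opposite edges; even ones preserve the
    cyclic order of these pairs and odd ones reverse it. *)
Lemma opposite_pair_perm (p : 'S_4) :
  opposite_pair (p v0) (p v2) = opposite_pair (p v0) (p v1) + (-1) ^+ odd_perm p.
Proof.
have [ts -> ts_neq] := prod_tpermP p.
elim/last_ind: ts ts_neq => [_|ts [x y] IH].
  by rewrite big_nil odd_perm1 !perm1; apply/eqP.
rewrite all_rcons => /andP[/= xy /IH{IH}]; rewrite -cats1 big_cat big_seq1 /=.
set s := (\prod_(t <- ts) _)%g; rewrite odd_permM odd_tperm xy !permM.
move: (perm4_uniq s); move: (s v0) (s v1) (s v2) (s v3) (odd_perm s).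
move=> a b c d o.
(* Each further transposition negates the difference of the two pairs, which is a finite check. *)
suff E: uniq [:: a; b; c; d] ->
  opposite_pair (tperm x y a) (tperm x y c) - opposite_pair (tperm x y a) (tperm x y b)
   = opposite_pair a b - opposite_pair a c.
  move=> /E /eqP; rewrite subr_eq => /eqP-> ->.
  by case: o => /=; rewrite ?expr0 ?expr1; ring.
rewrite !permE /= {o}.
by move: a b c d; ord4_cases=> _; elim/ord4_ind: x xy; elim/ord4_ind: y => // _;
   apply/eqP.
Qed.

(** * Weights on the edges of tetrahedra *)

Section Weights.
Context (N : nat) (q : 'I_N -> 'Z_3).
Implicit Types (w : 'I_N -> 'I_4 -> 'I_4 -> nat) (i : 'I_N) (p : 'S_4).

Lemma label_perm i p :
  label q i (p v0) (p v2) = label q i (p v0) (p v1) + (-1) ^+ odd_perm p.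
Proof. by rewrite /label opposite_pair_perm addrAC. Qed.

(** Weights treat two cases alike: membership of edges in an edge class, and the number of turns of
    a curve around each edge. *)
Definition sym_weight w := forall i a b, w i a b = w i b a.

Definition label_weight w i (t : 'Z_3) : nat :=
  (\sum_(ab : 'I_4 * 'I_4 | (ab.1 < ab.2) && (label q i ab.1 ab.2 == t)%R)
     w i ab.1 ab.2)%N.

Definition face_weight w i (f : 'I_4) : nat :=
  (\sum_(ab : 'I_4 * 'I_4 | [&& ab.1 < ab.2, ab.1 != f & ab.2 != f])
     w i ab.1 ab.2)%N.

Lemma sum_pairs4 (P : rel 'I_4) (F : 'I_4 -> 'I_4 -> nat) :
  (\sum_(ab : 'I_4 * 'I_4 | (ab.1 < ab.2) && P ab.1 ab.2) F ab.1 ab.2 =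
  (if P v0 v1 then F v0 v1 else 0) + (if P v0 v2 then F v0 v2 else 0) +
  (if P v0 v3 then F v0 v3 else 0) + (if P v1 v2 then F v1 v2 else 0) +
  (if P v1 v3 then F v1 v3 else 0) + (if P v2 v3 then F v2 v3 else 0))%N.
Proof.
rewrite big_mkcond.
rewrite -(pair_bigA _ (fun a b : 'I_4 => if (a < b)%N && P a b then F a b else 0)%N) /=.
rewrite !big_ord4 /=.
rewrite !add0r !addr0 !addrA.
by [].
Qed.

Lemma label_weight_perm w i p : sym_weight w ->
  label_weight w i (label q i (p v0) (p v1)) =
  (w i (p v0) (p v1) + w i (p v2) (p v3))%N.
Proof.
move=> wC; rewrite /label_weight (sum_pairs4 (fun a b => label q i a b == _)).
rewrite /label !(can_eq (subrK _)).
move: (perm4_uniq p); move: (p v0) (p v1) (p v2) (p v3).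
have := (wC i v1 v0, wC i v2 v0, wC i v3 v0, wC i v2 v1, wC i v3 v1, wC i v3 v2).
move=> E.
by ord4_cases=> _; eval_ifs; do ?rewrite !E; rewrite ?addn0 ?add0n // addnC.
Qed.

Lemma face_weight_perm w i p : sym_weight w ->
  face_weight w i (p v0) = (w i (p v1) (p v2) + w i (p v1) (p v3) + w i (p v2) (p v3))%N.
Proof.
move=> wC; rewrite /face_weight (sum_pairs4 (fun a b => (a != _) && (b != _))).
move: (perm4_uniq p); move: (p v0) (p v1) (p v2) (p v3).
have := (wC i v1 v0, wC i v2 v0, wC i v3 v0, wC i v2 v1, wC i v3 v1, wC i v3 v2).
move=> E.
ord4_cases=> _; eval_ifs; do ?rewrite !E; rewrite ?addn0 ?add0n //; lia.
Qed.

End Weights.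

Lemma Z3_ind (P : 'Z_3 -> Prop) : P 0 -> P 1 -> P (1 + 1) -> forall t, P t.
Proof.
move=> P0 P1 P2 [[|[|[|//]]] i].
- by rewrite (_ : Ordinal i = 0) //; apply: val_inj.
- by rewrite (_ : Ordinal i = 1) //; apply: val_inj.
- by rewrite (_ : Ordinal i = 1 + 1) //; apply: val_inj.
Qed.

Lemma big_Z3 (S : nmodType) (F : 'Z_3 -> S) : \sum_t F t = F 0 + (F 1 + F (1 + 1)).
Proof.
rewrite !big_ord_recl big_ord0 addr0.
by congr (F _ + (F _ + F _)); apply: val_inj.
Qed.

(** The alternating group on four letters is sharply 2-transitive, so even permutations correspond
    to oriented edges. *)
Lemma sum_even_perm (F : 'I_4 -> 'I_4 -> int) :
  \sum_(p : 'S_4 | ~~ odd_perm p) F (p v0) (p v1) =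
  \sum_(ab : 'I_4 * 'I_4 | ab.1 != ab.2) F ab.1 ab.2.
Proof.
rewrite (partition_big (fun p : 'S_4 => (p v0, p v1))
  (fun ab : 'I_4 * 'I_4 => ab.1 != ab.2)) /=; last first.
  by move=> p _; rewrite (inj_eq perm_inj).
apply: eq_bigr => -[a b] /= ab.
have [p [p_even pa pb]] : exists p : 'S_4, [/\ ~~ odd_perm p, p v0 = a & p v1 = b].
  (* [r] takes [v0] to [a] and [v1] to [b]; if it is odd, exchanging [v2] and [v3] first repairs the
     parity. *)
  pose r : 'S_4 := (tperm v1 (tperm v0 a b) * tperm v0 a)%g.
  have r0 : r v0 = a.
    rewrite permM [tperm v1 _ v0]tpermD ?tpermL //.
    by rewrite -[X in _ != X](tpermR v0 a) (inj_eq perm_inj) eq_sym.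
  have r1 : r v1 = b by rewrite permM tpermL tpermK.
  clearbody r; case rE: (odd_perm r); last by exists r; rewrite rE.
  exists (tperm v2 v3 * r)%g; rewrite odd_permM odd_tperm rE /=.
  by split; rewrite // permM tpermD.
rewrite (big_pred1 p) ?pa ?pb // => r /=; apply/andP/eqP => [[r_even]|->]; last first.
  by rewrite pa pb.
move=> /eqP[ra rb].
(* Even permutations follow the cyclic order of the opposite pairs, so the first two values
   determine the third. *)
have r2 : r v2 = p v2.
  have := opposite_pair_perm r; have := opposite_pair_perm p.
  rewrite (negPf p_even) (negPf r_even) ra rb pa pb => <-.
  have := perm4_uniq p; have := perm4_uniq r; rewrite ra rb pa pb.
  move: (r v2) (r v3) (p v2) (p v3) => c d c' d'.
  move: a b c d {ab pa pb ra rb}; ord4_cases=> _;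
    move: c' d'; elim/ord4_ind => //; elim/ord4_ind => // _ /eqP.
have r3 : r v3 = p v3.
  have := perm4_uniq p; have := perm4_uniq r; rewrite r2 ra rb pa pb.
  move=> + u; move: a b (p v2) (p v3) u {ab pa pb ra rb r2}.
  by ord4_cases=> _; elim/ord4_ind: (r v3).
by apply/permP; elim/ord4_ind; rewrite ?ra ?rb ?pa ?pb.
Qed.

(** * The Neumann-Zagier pairing *)

Section Gluing.
Context (N : nat) (T : gluing N) (q : 'I_N -> 'Z_3) (hT : oriented_gluing T).
Implicit Types (w : 'I_N -> 'I_4 -> 'I_4 -> nat) (i : 'I_N) (x y : turn N).

Definition glued (x : 'I_N * 'I_4) := (nbr T x.1 x.2, glue T x.1 x.2 x.2).

Lemma gluedK : involutive glued.
Proof. by case=> i f; rewrite /glued /=; have [-> -> _ _] := hT i f; rewrite permK. Qed.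

Lemma glued_neq (x : 'I_N * 'I_4) : glued x != x.
Proof. by case: x => i f; have [_ _] := hT i f. Qed.

Definition glue_invariant w := forall i f a b, a != f -> b != f ->
  w (nbr T i f) (glue T i f a) (glue T i f b) = w i a b.

Definition class_weight e i a b : nat :=
  same_oedge T (i, (a, b)) e || same_oedge T (i, (b, a)) e.

Lemma class_weight_sym e : sym_weight (class_weight e).
Proof. by move=> i a b; rewrite /class_weight orbC. Qed.

Lemma same_oedge_glue e i f a b : a != f -> b != f ->
  same_oedge T (nbr T i f, (glue T i f a, glue T i f b)) e =
  same_oedge T (i, (a, b)) e.
Proof.
move=> af bf; have [nK gK _ _] := hT i f.
have step : edge_step T (i, (a, b)) (nbr T i f, (glue T i f a, glue T i f b)).
  by apply/existsP; exists f; rewrite /= !(eq_sym f) af bf eqxx.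
have back : edge_step T (nbr T i f, (glue T i f a, glue T i f b)) (i, (a, b)).
  apply/existsP; exists (glue T i f f).
  by rewrite /= !(inj_eq perm_inj) !(eq_sym f) af bf nK gK !permK eqxx.
by apply/idP/idP; apply: connect_trans; apply: connect1.
Qed.

Lemma class_weight_glue e : glue_invariant (class_weight e).
Proof. by move=> i f a b af bf; rewrite /class_weight !same_oedge_glue. Qed.

Lemma edge_coefE e i t : edge_coef T q e i t = (label_weight q (class_weight e) i t)%:Z.
Proof.
rewrite /edge_coef -sum1_card; congr Posz.
rewrite big_mkcond [RHS]big_mkcond; apply: eq_bigr => -[a b] _.
by rewrite inE /=; case: (a < b)%N => //=; case: (_ == t).
Qed.

(* The height of a side of a horospherical triangle depends only on the face
   that contains it: the weight of the edge of this face away from the cusp,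
   minus the weights of its two edges which end there. *)
Definition exit_height w x : int :=
  (w x.1 (x.2 v1) (x.2 v3))%:Z - (w x.1 (x.2 v0) (x.2 v1))%:Z
  - (w x.1 (x.2 v0) (x.2 v3))%:Z.

Definition entry_height w x : int :=
  (w x.1 (x.2 v1) (x.2 v2))%:Z - (w x.1 (x.2 v0) (x.2 v1))%:Z
  - (w x.1 (x.2 v0) (x.2 v2))%:Z.

(** The next turn may go around either of the two corners at the ends of the shared side, and the
    height is symmetric in these corners. *)
Lemma follows_height w x y : sym_weight w -> glue_invariant w ->
  follows T x y -> entry_height w y = exit_height w x.
Proof.
case: x y => i p [j r] wC wT /and3P[/= /eqP-> /eqP r0 /eqP r3].
rewrite /entry_height /exit_height /= r0.
have glueE a b : a != v2 -> b != v2 ->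
    w (nbr T i (p v2)) (glue T i (p v2) (p a)) (glue T i (p v2) (p b)) =
    w i (p a) (p b).
  by move=> a2 b2; rewrite wT // (inj_eq perm_inj).
have := perm4_uniq (p * glue T i (p v2)); rewrite !permM => u.
have other k : k != v0 -> k != v3 ->
    r k = glue T i (p v2) (p v1) \/ r k = glue T i (p v2) (p v3).
  by move=> k0 k3; apply: (ord4_other u); rewrite -?r0 -?r3 (inj_eq perm_inj).
have r12 : r v1 != r v2 by rewrite (inj_eq perm_inj).
have [r1|r1] := other v1 isT isT; have [r2|r2] := other v2 isT isT;
  rewrite r1 r2 ?glueE //.
- by rewrite r1 r2 eqxx in r12.
- by rewrite addrAC (wC i (p v3)).
- by rewrite r1 r2 eqxx in r12.
Qed.

(** The weight of the edge at the corner cancels between the two heights. What remains is the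
    difference of the two other opposite pairs, whose labels come in the order given by the parity
    of the turn. *)
Lemma turn_height w x : sym_weight w ->
  (-1) ^+ odd_perm x.2 *
    ((label_weight q w x.1 (label q x.1 (x.2 v0) (x.2 v1) + 1))%:Z -
     (label_weight q w x.1 (label q x.1 (x.2 v0) (x.2 v1) + (1 + 1)))%:Z) =
  exit_height w x - entry_height w x.
Proof.
case: x => i p wC /=; rewrite /exit_height /entry_height /=.
have := label_perm q i p; have := label_perm q i (tperm v2 v3 * p)%g.
have := label_weight_perm q i (tperm v1 v2 * p)%g wC.
have := label_weight_perm q i (tperm v1 v3 * p)%g wC.
rewrite odd_permM odd_tperm /= !permM !permE /=.
have -> : (1 + 1 : 'Z_3) = -1 by apply/eqP.
move=> E3 E2 L3 L2; move: E3 E2; rewrite L2 L3.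
case: (odd_perm p); rewrite /= ?expr0 ?expr1 => -> ->;
  rewrite (wC i (p v2) (p v1)) !PoszD; ring.
Qed.

(** The Neumann-Zagier symplectic form, in the cyclic shape it has before z' is eliminated. *)
Definition NZ_form (G H : 'I_N -> 'Z_3 -> int) : int :=
  \sum_i \sum_t H i t * (G i (t + 1) - G i (t + (1 + 1))).

Lemma sum_curve_coef n (c : n.-tuple (turn N)) (g : 'I_N -> 'Z_3 -> int) :
  \sum_i \sum_t curve_coef q c i t * g i t =
  \sum_(x <- c) (-1) ^+ odd_perm x.2 * g x.1 (label q x.1 (x.2 v0) (x.2 v1)).
Proof.
rewrite pair_bigA /=.
under eq_bigr do rewrite /curve_coef big_mkcond big_distrl.
rewrite exchange_big /=; apply: eq_bigr => x _.
rewrite (bigD1 (x.1, label q x.1 (x.2 v0) (x.2 v1))) //= !eqxx /=.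
rewrite big1 ?addr0 // => -[i t] /= it.
case: ifP => [/andP[/eqP xi /eqP xt]|_]; last by rewrite mul0r.
by rewrite -xt -xi eqxx in it.
Qed.

Lemma NZ_form_curve w n (c : n.-tuple (turn N)) : sym_weight w ->
  glue_invariant w -> closed_curve T c ->
  NZ_form (fun i t => (label_weight q w i t)%:Z) (curve_coef q c) = 0.
Proof.
move=> wC wT cc; rewrite /NZ_form.
pose g i t : int := (label_weight q w i (t + 1))%:Z - (label_weight q w i (t + (1 + 1)))%:Z.
rewrite (sum_curve_coef c g).
under eq_bigr do rewrite turn_height //.
rewrite big_tuple sumrB [X in _ - X](reindex_inj (@ordS_inj n)) /=.
by rewrite -sumrB big1 // => k _; rewrite (follows_height wC wT (cc k)) subrr.
Qed.

End Gluing.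

(** * Parity *)

Lemma sum_off_diagonal (S : pzSemiRingType) n (F : 'I_n -> 'I_n -> S) :
  (forall a b, F a b = F b a) ->
  \sum_(ab : 'I_n * 'I_n | ab.1 != ab.2) F ab.1 ab.2 =
  2 * \sum_(ab : 'I_n * 'I_n | (ab.1 < ab.2)%N) F ab.1 ab.2.
Proof.
move=> FC; pose swap (ab : 'I_n * 'I_n) := (ab.2, ab.1).
rewrite (bigID (fun ab : 'I_n * 'I_n => ab.1 < ab.2)%N) /= mulr_natl mulr2n.
congr (_ + _).
  apply: eq_bigl => -[a b] /=; rewrite -val_eqE /=.
  by case: ltngtP => // /ltn_eqF.
rewrite (reindex_inj (can_inj (g := swap) (f := swap) _)) /=; last by case.
apply: eq_big => [[a b]|[a b] _] /=; last by rewrite FC.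
by rewrite -val_eqE /=; case: ltngtP.
Qed.

Lemma even_sum_involution (I : finType) (g : I -> I) (w : I -> nat) :
  involutive g -> (forall x, g x != x) -> (forall x, w (g x) = w x) ->
  ~~ odd (\sum_x w x).
Proof.
(* All orbits of [g] have two elements, and [lt] selects one of them. *)
move=> gK gx wg; pose lt x := (enum_rank x < enum_rank (g x))%N.
rewrite (bigID lt) /= [X in (_ + X)%N](reindex_inj (inv_inj gK)) /=.
rewrite [X in (_ + X)%N](_ : _ = \sum_(x | lt x) w x)%N ?addnn ?odd_double //.
apply: eq_big => [x|x _]; last exact: wg.
rewrite /lt gK -leqNgt leq_eqVlt; case: eqP => // /val_inj /enum_rank_inj E.
by have := gx x; rewrite -E eqxx.
Qed.

Lemma bin2D m n : 'C(m + n, 2) = ('C(m, 2) + 'C(n, 2) + m * n)%N.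
Proof.
elim: m => [|m IH]; first by rewrite add0n mul0n addn0.
by rewrite addSn !binS !bin1 IH; lia.
Qed.

Section Parity.
Context (N : nat) (T : gluing N) (q : 'I_N -> 'Z_3) (hT : oriented_gluing T).
Implicit Types (w : 'I_N -> 'I_4 -> 'I_4 -> nat) (i : 'I_N) (x y : turn N).

(** For edges counted by label, this is the number of pairs of occurrences with different labels,
    that is, at edges neither equal nor opposite. *)
Definition esym2 (G : 'Z_3 -> nat) : nat :=
  (G 0%R * G 1%R + G 1%R * G (1 + 1)%R + G (1 + 1)%R * G 0%R)%N.

Lemma esym2_shift (G : 'Z_3 -> nat) t :
  esym2 G = (G t * G (t + 1)%R + G (t + 1)%R * G (t + (1 + 1))%R
    + G (t + (1 + 1))%R * G t)%N.
Proof.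
have E1 : (1 + (1 + 1) : 'Z_3) = 0 by apply/eqP.
have E2 : (1 + 1 + (1 + 1) : 'Z_3) = 1 by apply/eqP.
have E3 : (1 + 1 + 1 : 'Z_3) = 0 by apply/eqP.
by elim/Z3_ind: t; rewrite ?add0r ?E1 ?E2 ?E3 /esym2; ring.
Qed.

(* Each pair of edges of a tetrahedron which are not opposite spans exactly one
   of its faces. *)
Lemma esym2_faces w i : sym_weight w ->
  odd (esym2 (label_weight q w i)) = odd (\sum_f 'C(face_weight w i f, 2)).
Proof.
move=> wC; rewrite (esym2_shift _ (label q i v0 v1)).
have := label_weight_perm q i 1 wC; have := label_weight_perm q i (tperm v1 v2) wC.
have := label_weight_perm q i (tperm v1 v3) wC.
have := label_perm q i 1; have := label_perm q i (tperm v2 v3).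
rewrite odd_perm1 odd_tperm /= !permE /= expr0 expr1 => L3 L2.
have E : (1 + 1 : 'Z_3) = -1 by apply/eqP.
rewrite L2 L3 E => -> -> ->.
have F0 := face_weight_perm i 1 wC; have F1 := face_weight_perm i (tperm v0 v1) wC.
have F2 := face_weight_perm i (tperm v0 v2) wC.
have F3 := face_weight_perm i (tperm v0 v3) wC.
move: F0 F1 F2 F3; rewrite !permE /= => F0 F1 F2 F3.
rewrite big_ord4 F0 F1 F2 F3 !bin2D.
rewrite ?(wC i v1 v0) ?(wC i v2 v0) ?(wC i v3 v0) ?(wC i v2 v1) ?(wC i v3 v1)
  ?(wC i v3 v2).
move: (w i v0 v1) (w i v0 v2) (w i v0 v3) (w i v1 v2) (w i v1 v3) (w i v2 v3).
move=> a b c d e f.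
(* Every edge lies in two faces, so the pairs of occurrences at a single edge are counted twice; [s]
   collects them. *)
pose s := ('C(a, 2) + 'C(b, 2) + 'C(c, 2) + 'C(d, 2) + 'C(e, 2) + 'C(f, 2))%N.
transitivity (odd (s.*2 +
    ((a + f) * (b + e) + (b + e) * (c + d) + (c + d) * (a + f))))%N.
  by rewrite [RHS]oddD odd_double.
by congr odd; rewrite /s -addnn; ring.
Qed.

(** Only the total weights of glued faces have to agree. This weaker form of invariance is the one
    available for curves. *)
Lemma esym2_even w : sym_weight w ->
  (forall i f, face_weight w (nbr T i f) (glue T i f f) = face_weight w i f) ->
  ~~ odd (\sum_i esym2 (label_weight q w i)).
Proof.
move=> wC wT.
have -> : odd (\sum_i esym2 (label_weight q w i)) =
    odd (\sum_i \sum_f 'C(face_weight w i f, 2)).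
  elim/big_ind2: _ => // [a b c d ab cd|i _]; first by rewrite !oddD ab cd.
  exact: esym2_faces.
rewrite pair_bigA /=.
apply: (even_sum_involution (gluedK hT) (glued_neq hT)) => -[i f].
by rewrite /glued /= wT.
Qed.

Lemma face_weight_glue w : sym_weight w -> glue_invariant T w ->
  forall i f, face_weight w (nbr T i f) (glue T i f f) = face_weight w i f.
Proof.
move=> wC wT i f; have := face_weight_perm i (tperm v0 f) wC.
have := face_weight_perm (nbr T i f) (tperm v0 f * glue T i f) wC.
have nf a : a != v0 -> tperm v0 f a != f.
  by move=> a0; rewrite -[X in _ != X](tpermL v0) (inj_eq perm_inj).
by rewrite !permM !wT ?nf // tpermL => -> ->.
Qed.

Definition turn_weight x i a b : nat :=
  (x.1 == i) && ((x.2 v0 == a) && (x.2 v1 == b) || (x.2 v0 == b) && (x.2 v1 == a)).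

Lemma label_weight_turn x i t :
  label_weight q (turn_weight x) i t = (x.1 == i) && (label q i (x.2 v0) (x.2 v1) == t).
Proof.
rewrite /label_weight (sum_pairs4 (fun a b => label q i a b == t)) /turn_weight.
case: x => j p /=; case: (j == i) => //=; last by do !case: ifP.
rewrite /label !subr_eq; move: (t + q i) => {}t.
move: (perm4_uniq p); move: (p v0) (p v1) (p v2) (p v3).
by ord4_cases=> _; elim/Z3_ind: t.
Qed.

(** The two faces containing the edge at the corner are those through which the turn enters and
    leaves. *)
Lemma face_weight_turn x i f :
  face_weight (turn_weight x) i f = (x.1 == i) && ((x.2 v2 == f) || (x.2 v3 == f)).
Proof.
rewrite /face_weight (sum_pairs4 (fun a b => (a != f) && (b != f))) /turn_weight.
case: x => j p /=; case: (j == i) => //=; last by do !case: ifP.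
move: (perm4_uniq p); move: (p v0) (p v1) (p v2) (p v3).
by ord4_cases=> _; elim/ord4_ind: f.
Qed.

Definition curve_weight n (c : n.-tuple (turn N)) i a b : nat :=
  (\sum_(x <- c) turn_weight x i a b)%N.

Lemma curve_weight_sym n (c : n.-tuple (turn N)) : sym_weight (curve_weight c).
Proof. by move=> i a b; apply: eq_bigr => x _; rewrite /turn_weight orbC. Qed.

Lemma odd_curve_coef n (c : n.-tuple (turn N)) i t :
  (curve_coef q c i t == (label_weight q (curve_weight c) i t)%:Z %[mod 2])%Z.
Proof.
rewrite /label_weight /curve_weight exchange_big /=.
under eq_bigr do rewrite -/(label_weight q (turn_weight _) i t) label_weight_turn.
rewrite /curve_coef big_mkcond /=.
elim/big_ind2: _ => // [a b m p am bp|x _].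
  by rewrite PoszD; apply/eqP; rewrite -[LHS]modzDm (eqP am) (eqP bp) modzDm.
have [<-|_] := eqVneq x.1 i; rewrite //=.
by case: ifP => // _; case: odd_perm.
Qed.

(** The weight of a face counts the exits and the entries of the curve through it; gluing exchanges
    these two numbers, since each exit is followed by an entry on the other side. *)
Lemma face_weight_curve n (c : n.-tuple (turn N)) : closed_curve T c ->
  forall i f, face_weight (curve_weight c) (nbr T i f) (glue T i f f) =
    face_weight (curve_weight c) i f.
Proof.
move=> cc.
pose ent (y : 'I_N * 'I_4) :=
  (\sum_(k < n) ((tnth c k).1 == y.1) && ((tnth c k).2 v3 == y.2))%N.
pose ext (y : 'I_N * 'I_4) :=
  (\sum_(k < n) ((tnth c k).1 == y.1) && ((tnth c k).2 v2 == y.2))%N.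
have fE i f : face_weight (curve_weight c) i f = (ext (i, f) + ent (i, f))%N.
  rewrite /face_weight /curve_weight exchange_big /= big_tuple /ext /ent -big_split /=.
  apply: eq_bigr => k _; rewrite -/(face_weight (turn_weight _) i f) face_weight_turn.
  case: (_ == i) => //=; case: eqP => [<-|//].
  by rewrite (inj_eq perm_inj).
have entE (y : 'I_N * 'I_4) : ent (glued T y) = ext y.
  rewrite /ent (reindex_inj (@ordS_inj n)) /=; apply: eq_bigr => k _.
  have /and3P[/eqP n1 _ /eqP n3] := cc k; congr nat_of_bool.
  have := inj_eq (inv_inj (gluedK hT)) ((tnth c k).1, (tnth c k).2 v2) y.
  by rewrite /glued !xpair_eqE /= n1 n3 => ->; case: y.
move=> i f; rewrite !fE -[(nbr T i f, _)]/(glued T (i, f)) entE.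
by rewrite -(entE (glued T (i, f))) (gluedK hT) addnC.
Qed.

End Parity.

(** * The gluing matrices *)

Lemma dvdz_pronic (b : int) : (2 %| b * (b + 1))%Z.
Proof.
have [E|E] : (b %% 2 = 0 \/ b %% 2 = 1)%Z by lia.
  by rewrite dvdz_mulr // /dvdz; apply/dvdz_mod0P.
rewrite dvdz_mull // (divz_eq b 2) E -addrA -[1 + 1]mul1r -mulrDl.
by rewrite dvdz_mull.
Qed.

Section Symplectic.
Context (N : nat) (T : gluing N) (q : 'I_N -> 'Z_3) (hT : oriented_gluing T).
Implicit Types (w : 'I_N -> 'I_4 -> 'I_4 -> nat) (i : 'I_N) (x y : turn N).

Lemma labelC i a b : label q i a b = label q i b a.
Proof. by rewrite /label opposite_pairC. Qed.

Lemma pivot_inj : injective (pivot T).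
Proof.
pose back (y : turn N) : turn N := (nbr T y.1 (y.2 v3),
  (tperm v2 v3 * (y.2 * glue T y.1 (y.2 v3)))%g).
apply: (can_inj (g := back)) => -[i p].
rewrite /back /pivot /= !permM tpermR; have [-> -> _ _] := hT i (p v2).
by rewrite mulgK mulgA tperm2 mul1g.
Qed.

Lemma follows_pivot x : follows T x (pivot T x).
Proof. by rewrite /follows /pivot /= !permM tpermR tpermD // !eqxx. Qed.

Lemma odd_pivot x : odd_perm (pivot T x).2 = odd_perm x.2.
Proof.
have [_ _ _ ox] := hT x.1 (x.2 v2).
by rewrite /pivot /= !odd_permM odd_tperm ox /= addbT negbK.
Qed.

Lemma sum_label_weight w i (g : 'Z_3 -> int) :
  \sum_t (label_weight q w i t)%:Z * g t =
  \sum_(ab : 'I_4 * 'I_4 | (ab.1 < ab.2)%N)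
     (w i ab.1 ab.2)%:Z * g (label q i ab.1 ab.2).
Proof.
rewrite (partition_big (fun ab : 'I_4 * 'I_4 => label q i ab.1 ab.2) xpredT) //=.
apply: eq_bigr => t _; rewrite /label_weight (big_morph Posz PoszD (erefl _)) big_distrl /=.
by apply: eq_bigr => ab /andP[_ /eqP->].
Qed.

(* The turns around an edge form pivot orbits, along which the heights
   telescope. *)
Lemma NZ_form_weights w w' : sym_weight w -> sym_weight w' ->
  glue_invariant T w -> glue_invariant T w' ->
  NZ_form (fun i t => (label_weight q w i t)%:Z)
    (fun i t => (label_weight q w' i t)%:Z) = 0.
Proof.
(* Doubling replaces unoriented edges by oriented ones, hence by the turns [(i, p)] with [p]
   even. *)
move=> wC wC' wT wT'; apply: (@mulfI _ (2 : int)) => //; rewrite mulr0 /NZ_form.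
pose g i t : int := (label_weight q w i (t + 1))%:Z - (label_weight q w i (t + (1 + 1)))%:Z.
transitivity (\sum_i \sum_(p : 'S_4 | ~~ odd_perm p)
    (w' i (p v0) (p v1))%:Z * (exit_height w (i, p) - entry_height w (i, p))).
  rewrite big_distrr /=; apply: eq_bigr => i _.
  rewrite (sum_label_weight w' i (g i)).
  rewrite -(sum_off_diagonal (F := fun a b => (w' i a b)%:Z * g i (label q i a b))); last first.
    by move=> a b; rewrite wC' labelC.
  rewrite -(sum_even_perm (fun a b => (w' i a b)%:Z * g i (label q i a b))).
  apply: eq_bigr => p /negPf op; congr (_ * _).
  by have := turn_height q (i, p) wC; rewrite /= op expr0 mul1r => <-.
rewrite pair_big_dep /=.
transitivity (\sum_(x : turn N | ~~ odd_perm x.2)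
    ((w' x.1 (x.2 v0) (x.2 v1))%:Z * exit_height w x -
     (w' x.1 (x.2 v0) (x.2 v1))%:Z * entry_height w x)).
  by apply: eq_bigr => -[i p] _; rewrite mulrBr.
rewrite sumrB [X in _ - X](reindex_inj pivot_inj) /=.
rewrite [X in _ - X](eq_bigl (fun x : turn N => ~~ odd_perm x.2)); last first.
  by move=> x; rewrite odd_pivot.
rewrite -sumrB big1 // => x _.
(* A pivot goes around the same edge, so the factor [w'] is unchanged. *)
rewrite (follows_height wC wT (follows_pivot x)) /pivot /= !permM !(tpermD (z := v0)) //.
by rewrite !tpermD // wT' ?subrr // (inj_eq perm_inj).
Qed.

(** The products of two z' coefficients cancel in the difference, and the other six terms form the
    cyclic expression. *)
Lemma is_row_NZ_form (A B : 'M[int]_N) nu j l G H r s :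
  is_row A B nu j G r -> is_row A B nu l H s ->
  (A *m B^T) j l - (A *m B^T) l j = NZ_form G H.
Proof.
move=> [Aj Bj _] [Al Bl _]; rewrite !mxE -sumrB; apply: eq_bigr => i _.
have E1 : (1 + (1 + 1) : 'Z_3) = 0 by apply/eqP.
have E2 : (1 + 1 + (1 + 1) : 'Z_3) = 1 by apply/eqP.
have E3 : (1 + 1 + 1 : 'Z_3) = 0 by apply/eqP.
have E4 : (1 + 1 : 'Z_3) = 2 by apply/eqP.
rewrite !mxE Aj Bj Al Bl big_Z3 !add0r E1 E2 E3 E4; ring.
Qed.

(** Modulo 2, the product of [G 0 - G 1] and [G 2 - G 1] is the second elementary symmetric
    polynomial plus the square of [G 1], and this square is congruent to the contribution of [G 1]
    to [nu]. *)
Lemma is_row_parity (A B : 'M[int]_N) nu j G r (G' : 'I_N -> 'Z_3 -> nat) :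
  is_row A B nu j G r -> (2 %| r)%Z ->
  (forall i t, (G i t == (G' i t)%:Z %[mod 2])%Z) ->
  ~~ odd (\sum_i esym2 (G' i)) -> (2 %| nu j ord0 - (A *m B^T) j j)%Z.
Proof.
move=> [Aj Bj ->] r2 GG' even_G'.
have dvd_sum (F : 'I_N -> int) : (forall i, (2 %| F i)%Z) -> (2 %| \sum_i F i)%Z.
  by move=> F2; elim/big_ind: _ => // *; rewrite ?dvdz0 ?rpredD.
suff /dvd_sum E : forall i, (2 %| G i 1%R + A j i * B j i - (esym2 (G' i))%:Z)%Z.
  have -> : r - \sum_i G i 1 - (A *m B^T) j j =
      r - \sum_i (G i 1 + A j i * B j i - (esym2 (G' i))%:Z)
      - (\sum_i esym2 (G' i))%N%:Z.
    have -> : (A *m B^T) j j = \sum_i A j i * B j i.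
      by rewrite mxE; apply: eq_bigr => i _; rewrite mxE.
    by rewrite sumrB big_split (big_morph Posz PoszD (erefl _)) /=; ring.
  by apply: rpredB; [exact: rpredB | rewrite dvdzE dvdn2].
move=> i; rewrite Aj Bj.
have dG t : {d | G i t = (G' i t)%:Z + d * 2}.
  exists ((G i t - (G' i t)%:Z) %/ 2)%Z; rewrite divzK ?subrKC //.
  by rewrite -eqz_mod_dvd.
have E : (1 + 1 : 'Z_3) = 2 by apply/eqP.
have [d0 ->] := dG 0; have [d1 ->] := dG 1; have [d2 ->] := dG 2.
rewrite /esym2 E; move: (G' i 0) (G' i 1) (G' i 2) => a b c.
rewrite !PoszD !PoszM.
set e := (X in (_ %| X)%Z).
have -> : e = b%:Z * (b%:Z + 1) + 2 * (a%:Z * d2 + c%:Z * d0 + 2 * d0 * d2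
    - a%:Z * b%:Z - a%:Z * d1 - b%:Z * d0 - 2 * d0 * d1 - b%:Z * c%:Z
    - b%:Z * d2 - c%:Z * d1 - 2 * d1 * d2 + 2 * b%:Z * d1 + 2 * d1 * d1 + d1).
  by rewrite /e; ring.
by rewrite rpredD ?dvdz_pronic // dvdz_mulr.
Qed.

Lemma gluing_matrices_sym A B nu : gluing_matrices T q A B nu ->
  (A *m B^T)^T = A *m B^T.
Proof.
move=> [_ [jc [e [n [c [[_ cc _] rowc rowe]]]]]].
have antisym G H : NZ_form G H = 0 -> forall j l r s,
    is_row A B nu j G r -> is_row A B nu l H s -> (A *m B^T) j l = (A *m B^T) l j.
  by move=> GH j l r s Hj Hl; apply/eqP; rewrite -subr_eq0 (is_row_NZ_form Hj Hl) GH.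
have edge_row j : j != jc ->
    is_row A B nu j (fun i t => (label_weight q (class_weight T (e j)) i t)%:Z) 2.
  move=> /rowe[_ [Aj Bj nuj]]; split=> [i|i|]; rewrite -?edge_coefE //.
  by rewrite nuj; congr (_ - _); apply: eq_bigr => i _; rewrite edge_coefE.
apply/matrixP => j l; rewrite mxE.
(* In a mixed pair of rows the curve is put second, as in [NZ_form_curve]; two edge rows fall under
   [NZ_form_weights]. *)
have [-> | lc] := eqVneq l jc; have [-> // | jc'] := eqVneq j jc.
- apply/esym; apply: (antisym _ _ _ _ _ _ _ (edge_row _ jc') rowc).
  apply: NZ_form_curve cc; [exact: class_weight_sym | exact: class_weight_glue].
- apply: (antisym _ _ _ _ _ _ _ (edge_row _ lc) rowc).
  apply: NZ_form_curve cc; [exact: class_weight_sym | exact: class_weight_glue].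
apply: (antisym _ _ _ _ _ _ _ (edge_row _ lc) (edge_row _ jc')).
by apply: NZ_form_weights; do [exact: class_weight_sym | exact: class_weight_glue].
Qed.

Lemma gluing_matrices_parity A B nu : gluing_matrices T q A B nu ->
  forall j, (2 %| nu j ord0 - (A *m B^T) j j)%Z.
Proof.
move=> [_ [jc [e [n [c [[_ cc _] rowc rowe]]]]]] j.
have [-> | /rowe[_ rowj]] := eqVneq j jc.
  apply: (is_row_parity rowc) => //; first by move=> i t; exact: odd_curve_coef.
  by apply: (esym2_even q hT); [exact: curve_weight_sym | exact: face_weight_curve].
apply: (is_row_parity rowj (G' := label_weight q (class_weight T (e j)))) => //.
  by move=> i t; rewrite edge_coefE.
apply: (esym2_even q hT); first exact: class_weight_sym.
by apply: face_weight_glue; [exact: class_weight_sym | exact: class_weight_glue].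
Qed.

End Symplectic.

(** * The integral quadratic form of a nondegenerate datum *)

Section NondegenerateMatrices.
Context (N : nat) (A B : 'M[int]_N) (nu : 'cV[int]_N).
Context (B_unit : B \in unitmx) (AB_sym : (A *m B^T)^T = A *m B^T).

(** This matrix is congruent to [A *m B^T]: multiply by [invmx B] on the left and by its transpose
    on the right. *)
Lemma quad_sym : (invmx B *m A)^T = invmx B *m A.
Proof.
have BT : B^T \in unitmx by rewrite unitmx_tr.
rewrite trmx_mul trmx_inv -[LHS](mulKmx B_unit) -[RHS](mulmxK BT) -!mulmxA.
by congr (_ *m _); rewrite mulmxA -AB_sym trmx_mul trmxK !mulmxA.
Qed.

(** In terms of the integer row [x], the sum is [x *m S *m x^T + x *m nu]. Off-diagonal terms come
    in equal pairs, and modulo 2 the diagonal ones are multiples of [x 0 a * (x 0 a + 1)]. *)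
Lemma quad_even (m : 'cV[int]_N) :
  (forall j, 2 %| nu j 0%R - (A *m B^T) j j)%Z ->
  (2 %| (m^T *m (invmx B *m A *m m)) 0%R 0%R + (m^T *m (invmx B *m nu)) 0%R 0%R)%Z.
Proof.
move=> nu_diag; pose x := m^T *m invmx B; set S := A *m B^T.
have -> : m^T *m (invmx B *m nu) = x *m nu by rewrite mulmxA.
have -> : m^T *m (invmx B *m A *m m) = x *m S *m x^T.
  have xB : x *m B = m^T by rewrite mulmxKV.
  by rewrite -[m in LHS](trmxK m) -xB trmxK trmx_mul !mulmxA mulmxK.
pose F a b := x 0 a * S a b * x 0 b.
have -> : (x *m S *m x^T) 0 0 = \sum_(ab : 'I_N * 'I_N) F ab.1 ab.2.
  rewrite -(pair_bigA _ F) exchange_big mxE; apply: eq_bigr => b _ /=.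
  by rewrite mxE big_distrl /=; apply: eq_bigr => a _; rewrite [x^T _ _]mxE.
rewrite (bigID (fun ab : 'I_N * 'I_N => ab.1 != ab.2)) /= sum_off_diagonal; last first.
  move=> a b; rewrite /F mulrAC [RHS]mulrAC [x 0 b * _]mulrC.
  by rewrite /S -{1}AB_sym [_^T a b]mxE.
rewrite -addrA rpredD ?dvdz_mulr //.
rewrite (reindex_onto (fun a : 'I_N => (a, a)) (fun ab => ab.1)) /=; last first.
  by move=> [a b] /= /negPn/eqP->.
rewrite (eq_bigl xpredT) => [|a]; last by rewrite !eqxx.
rewrite mxE -big_split /=; elim/big_ind: _ => // [*|a _]; first exact: rpredD.
have -> : F a a + x 0 a * nu a 0 =
  x 0 a * (nu a 0 - S a a) + x 0 a * (x 0 a + 1) * S a a by rewrite /F; ring.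
rewrite rpredD //; first by rewrite dvdz_mull.
by rewrite dvdz_mulr // dvdz_pronic.
Qed.

End NondegenerateMatrices.

(** * Roots of unity *)

Section Expi.
Context (R : realType).
Local Notation C := (complex R).

Lemma expiD (x y : R) : expi (x + y) = expi x * expi y.
Proof.
apply/eqP; rewrite eq_complex /= cosD sinD eqxx /=.
by apply/eqP; ring.
Qed.

Lemma expi0 : expi 0 = 1 :> C.
Proof. by rewrite /expi cos0 sin0. Qed.

Lemma expiMn (x : R) n : expi (x *+ n) = expi x ^+ n.
Proof.
elim: n => [|n IH]; first by rewrite mulr0n expi0.
by rewrite mulrS expiD IH exprS.
Qed.

Lemma expi_pi : expi pi = -1 :> C.
Proof. by apply/eqP; rewrite eq_complex /= cospi sinpi oppr0 !eqxx. Qed.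

Lemma expi_neq1 (x : R) : 0 < x -> x < 2 * pi -> expi x != 1.
Proof.
move=> x0 x2; apply/eqP => /(congr1 (@complex.Re R)) /=.
(* If cos x = 1, the double angle formula gives sin (x / 2) = 0, although x / 2 lies strictly
   between 0 and pi. *)
have xE : x = (x / 2) *+ 2 by rewrite -mulr_natr divfK // pnatr_eq0.
have /gt_eqF : 0 < sin (x / 2) by apply: sin_gt0_pi; apply/andP; split; lra.
have := cos2Dsin2 (x / 2); rewrite [in cos x]xE cos_mulr2n => cs sn ct.
have /eqP : sin (x / 2) ^+ 2 = 0 by lra.
by rewrite sqrf_eq0 sn.
Qed.

Lemma expi_neq0 (x : R) : expi x != 0.
Proof.
apply/eqP => E; have := oner_neq0 C.
by rewrite -expi0 -(subrr x) expiD E mul0r eqxx.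
Qed.

Lemma expi_int_pi (n : int) : expi (- (pi * n%:~R)) = (-1) ^ n :> C.
Proof.
have P m : expi (pi * m%:R) = (-1) ^+ m :> C by rewrite mulr_natr expiMn expi_pi.
have E y : expi (- y) = (expi y)^-1 :> C.
  by apply: (mulIf (expi_neq0 y)); rewrite -expiD addNr expi0 mulVf ?expi_neq0.
case: n => n; first by rewrite E P -exprnP -exprVn invrN1.
by rewrite NegzE mulrNz mulrN opprK P -exprnN -exprVn invrN1.
Qed.

Lemma zeta_prim k : (0 < k)%N -> k.-primitive_root (zeta R k).
Proof.
move=> k0; have kR : (k%:R : R) != 0 by rewrite pnatr_eq0 -lt0n.
apply/andP; split=> //; apply/forallP => -[j jk] /=; apply/eqP.
rewrite unity_rootE /zeta -expiMn; have [->|jk'] := eqVneq j.+1 k.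
  rewrite -[_ *+ k]mulr_natr divfK // [2 * _]mulr_natl expiMn expi_pi -signr_odd.
  by rewrite expr0 eqxx.
apply/negbTE/expi_neq1.
  by rewrite pmulrn_rgt0 // divr_gt0 ?mulr_gt0 ?pi_gt0 ?ltr0n.
rewrite -[_ *+ j.+1]mulr_natr mulrAC ltr_pdivrMr ?ltr0n // ltr_pM2l ?mulr_gt0 ?pi_gt0 //.
by rewrite ltr_nat ltn_neqAle jk' jk.
Qed.

End Expi.

Section RootsOfUnity.
Context (F : fieldType) (k : nat) (w : F).
Context (w_prim : k.-primitive_root w).

Lemma prod_root_of_unity (x : F) : \prod_(0 <= r < k) (1 - w ^+ r * x) = 1 - x ^+ k.
Proof.
have [->|x0] := eqVneq x 0.
  rewrite expr0n eqn0Ngt (prim_order_gt0 w_prim) subr0 big1 // => r _.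
  by rewrite mulr0 subr0.
(* The factorization of X^k - 1 is evaluated at 1/x and multiplied by x^k; hence the separate case x
   = 0. *)
have := congr1 (fun p : {poly F} => p.[x^-1]) (factor_Xn_sub_1 w_prim).
rewrite horner_prod !hornerE => E.
have <- : x ^+ k * (x^-1 ^+ k - 1) = 1 - x ^+ k.
  by rewrite mulrBr mulr1 -exprMn divff // expr1n.
rewrite -{}E -{2}(subn0 k) -prodr_const_nat -big_split /=.
apply: eq_bigr => r _.
by rewrite !hornerE mulrBr divff // mulrC.
Qed.

Lemma sum_root_of_unity_pow (a : int) :
  \sum_(r < k) (w ^ a) ^+ r = if (k %| a)%Z then k%:R else 0.
Proof.
have wk : (w ^ a) ^+ k = 1.
  by rewrite exprnP exprzAC -exprnP (prim_expr_order w_prim) exp1rz.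
have w0 : w != 0.
  apply/eqP => w0; have := prim_expr_order w_prim; rewrite w0.
  by rewrite expr0n eqn0Ngt (prim_order_gt0 w_prim) => /eqP; rewrite eq_sym oner_eq0.
have E : (w ^ a == 1) = (k %| a)%Z.
  rewrite dvdzE /= (prim_order_dvd w_prim).
  by case: a {wk} => n //=; exact: invr_eq1.
rewrite -E; have [->|wa] := eqVneq.
  under eq_bigr do rewrite expr1n.
  by rewrite sumr_const card_ord.
apply/eqP; have := subrX1 (w ^ a) k; rewrite wk subrr => /esym/eqP.
by rewrite mulf_eq0 subr_eq0 (negPf wa).
Qed.

Lemma prim_rootV : k.-primitive_root w^-1.
Proof.
have /andP[k_gt0 /forallP wP] := w_prim; apply/andP; split=> //; apply/forallP => i.
by rewrite unity_rootE exprVn invr_eq1 -unity_rootE.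
Qed.

End RootsOfUnity.

(** * Averaging Laurent polynomials *)

Section Laurent.
Context (F : fieldType) (K : divringClosed F) (N k : nat) (w : F) (z : 'I_N -> F).
Context (w_prim : k.-primitive_root w) (wK : w \in K).
Context (zK : forall i, z i \in K) (z0 : forall i, z i != 0).
Implicit Types (t : 'I_N -> F) (g h : ('I_N -> F) -> F).

Let k_gt0 : (0 < k)%N := prim_order_gt0 w_prim.

Definition kth_roots t := forall i, t i ^+ k = z i.

(** Agreement is required only on k-th roots of the fixed [z]. There t_i^k is a constant of [K], so
    some inverses of polynomials are Laurent polynomials too. *)
Definition laurent g := exists s : seq (F * ('I_N -> int)),
  all (fun p => p.1 \in K) s /\
  forall t, kth_roots t -> g t = \sum_(p <- s) p.1 * \prod_i t i ^ p.2 i.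

Lemma kth_roots_neq0 t i : kth_roots t -> t i != 0.
Proof.
move=> tz; apply: contra_neq (z0 i) => ti0.
by rewrite -tz ti0 expr0n eqn0Ngt k_gt0.
Qed.

Lemma eq_laurent g h : (forall t, kth_roots t -> g t = h t) -> laurent h -> laurent g.
Proof. by move=> gh [s [sK hE]]; exists s; split=> // t tz; rewrite gh ?hE. Qed.

Lemma laurent_const c : c \in K -> laurent (fun=> c).
Proof.
move=> cK; exists [:: (c, fun=> 0)]; split=> [|t _]; first by rewrite /= cK.
by rewrite big_seq1 big1 ?mulr1.
Qed.

Lemma laurent_exp i n : laurent (fun t => t i ^ n).
Proof.
exists [:: (1, fun j => if j == i then n else 0)]; split=> [|t _].
  by rewrite /= rpred1.
rewrite big_seq1 mul1r (bigD1 i) //= eqxx big1 ?mulr1 // => j /negPf->.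
by rewrite expr0z.
Qed.

Lemma laurentD g h : laurent g -> laurent h -> laurent (fun t => g t + h t).
Proof.
move=> [s [sK gE]] [u [uK hE]]; exists (s ++ u); rewrite all_cat sK uK.
by split=> // t tz; rewrite big_cat gE ?hE.
Qed.

Lemma laurentM g h : laurent g -> laurent h -> laurent (fun t => g t * h t).
Proof.
move=> [s [sK gE]] [u [uK hE]].
exists [seq (p.1 * r.1, fun i => p.2 i + r.2 i) | p <- s, r <- u]; split=> [|t tz].
  apply/all_allpairsP => p r ps ru /=.
  by rewrite rpredM ?(allP sK p ps) ?(allP uK r ru).
rewrite gE // hE // big_allpairs_dep big_distrl /=; apply: eq_bigr => p _.
rewrite big_distrr /=; apply: eq_bigr => r _.
rewrite mulrACA -big_split /=; congr (_ * _); apply: eq_bigr => i _.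
by rewrite expfzDr ?kth_roots_neq0.
Qed.

Lemma laurentX g n : laurent g -> laurent (fun t => g t ^+ n).
Proof.
move=> gL; elim: n => [|n IH]; first exact/laurent_const/rpred1.
by apply: eq_laurent (laurentM gL IH) => t _; rewrite exprS.
Qed.

Lemma laurent_sum (I : Type) (r : seq I) (P : pred I) (G : I -> ('I_N -> F) -> F) :
  (forall j, P j -> laurent (G j)) -> laurent (fun t => \sum_(j <- r | P j) G j t).
Proof.
move=> GL; elim: r => [|j r IH].
  by apply: eq_laurent (laurent_const (rpred0 K)) => t _; rewrite big_nil.
have [Pj|Pj] := boolP (P j).
  by apply: eq_laurent (laurentD (GL j Pj) IH) => t _; rewrite big_cons Pj.
by apply: eq_laurent IH => t _; rewrite big_cons (negPf Pj).
Qed.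

Lemma laurent_prod (I : Type) (r : seq I) (P : pred I) (G : I -> ('I_N -> F) -> F) :
  (forall j, P j -> laurent (G j)) -> laurent (fun t => \prod_(j <- r | P j) G j t).
Proof.
move=> GL; elim: r => [|j r IH].
  by apply: eq_laurent (laurent_const (rpred1 K)) => t _; rewrite big_nil.
have [Pj|Pj] := boolP (P j).
  by apply: eq_laurent (laurentM (GL j Pj) IH) => t _; rewrite big_cons Pj.
by apply: eq_laurent IH => t _; rewrite big_cons (negPf Pj).
Qed.

Lemma laurent_factor i c : c \in K -> laurent (fun t => 1 - c / t i).
Proof.
move=> cK; have L : laurent (fun t => - c * t i ^ (-1)).
  by apply: laurentM (laurent_exp i (-1)); apply: laurent_const; rewrite rpredN.
apply: eq_laurent (laurentD (laurent_const (rpred1 K)) L) => t _.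
by rewrite mulNr exprN1.
Qed.

(* [1 / (1 - x) = (1 + x + ... + x^(k-1)) / (1 - x^k)] with [x^k = 1 / z_i]. *)
Lemma laurent_factorV i r : z i != 1 -> laurent (fun t => (1 - w ^+ r / t i)^-1).
Proof.
move=> z1.
have L : laurent (fun t => \sum_(j < k) (w ^+ r * t i ^ (-1)) ^+ j).
  apply: laurent_sum => j _; apply: laurentX.
  by apply: laurentM (laurent_exp i (-1)); apply/laurent_const/rpredX.
have zK' : (1 - (z i)^-1)^-1 \in K by rewrite rpredV rpredB ?rpred1 // rpredV.
apply: eq_laurent (laurentM (laurent_const zK') L) => t tz.
have xk : (w ^+ r / t i) ^+ k = (z i)^-1.
  by rewrite exprMn exprVn tz exprAC (prim_expr_order w_prim) expr1n mul1r.
have xE := subrX1 (w ^+ r / t i) k; rewrite xk in xE.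
have zz : 1 - (z i)^-1 != 0 by rewrite subr_eq0 eq_sym invr_eq1.
rewrite exprN1; set x := w ^+ r / t i in xE *; set S := \sum_(j < k) _.
have zE : 1 - (z i)^-1 = (1 - x) * S by rewrite -opprB xE -mulNr opprB.
have x1 : 1 - x != 0 by apply: contra_neq zz => x1; rewrite zE x1 mul0r.
by apply: (mulfI zz); rewrite mulVKf // zE mulrAC divff // mul1r.
Qed.

Definition shift_root i t : 'I_N -> F := fun j => if j == i then w^-1 * t j else t j.

(* Averaging over the group of all rotations of the roots kills every monomial
   which is not a monomial in z. *)
Lemma laurent_invariant g t : laurent g ->
  (forall u i, kth_roots u -> g (shift_root i u) = g u) -> kth_roots t ->
  (k%:R : F) != 0 -> g t \in K.
Proof.
move=> [s [sK gE]] g_inv tz k0.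
pose rot (r : 'I_N -> nat) : 'I_N -> F := fun j => w^-1 ^+ r j * t j.
have rot_roots r : kth_roots (rot r).
  move=> j; rewrite /rot exprMn tz exprAC exprVn (prim_expr_order w_prim).
  by rewrite invr1 expr1n mul1r.
(* Induction on the total amount of rotation, removing one unit at a time. *)
have g_rot r : g (rot r) = g t.
  have [n] := ubnP (\sum_j r j)%N; elim: n r => // n IH r rn.
  have [i ri|r0] := pickP (fun i : 'I_N => r i != 0%N).
    pose r' j := if j == i then (r j).-1 else r j.
    rewrite -[RHS](IH r'); last first.
      move: rn; rewrite (bigD1 i) //= [X in _ -> (X < n)%N](bigD1 i) //= [r' i]/r' eqxx.
      rewrite [X in (_ + X < n)%N](eq_bigr r) => [|j /negPf]; last by rewrite /r' => ->.
      by move: ri; case: (r i) => // m _; rewrite ltnS.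
    rewrite -[RHS](g_inv _ i) //; congr g; apply/boolp.funext => j.
    rewrite /shift_root /rot /r'; case: eqP => [->|//].
    by rewrite mulrA -exprS prednK // lt0n.
  congr g; apply/boolp.funext => j; rewrite /rot.
  by move/(_ j)/negbFE/eqP: r0 => ->; rewrite mul1r.
(* k^N is the number of rotations over which [g] is summed. *)
suff: (k%:R ^+ N) * g t \in K.
  by move=> E; rewrite -[g t](mulKf (expf_neq0 N k0)) rpredM // rpredV rpredX ?rpred_nat.
have -> : k%:R ^+ N * g t = \sum_(r : {ffun 'I_N -> 'I_k}) g (rot (fun j => r j)).
  under eq_bigr do rewrite g_rot.
  by rewrite sumr_const card_ffun !card_ord -[RHS]mulr_natl natrX.
under eq_bigr do rewrite gE //.
rewrite exchange_big /= big_seq rpred_sum // => -[c a] /(allP sK) /= cK.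
rewrite -big_distrr rpredM //=.
(* The sum of a monomial over all rotations factors over the coordinates. Each factor vanishes
   unless k divides the exponent, and then it is a multiple of a power of [z i]. *)
rewrite -(bigA_distr_bigA (fun i (j : 'I_k) => (w^-1 ^+ j * t i) ^ a i)) /=.
apply: rpred_prod => i _.
have -> : \sum_(j < k) (w^-1 ^+ j * t i) ^ a i =
    (\sum_(j < k) (w^-1 ^ a i) ^+ j) * t i ^ a i.
  rewrite big_distrl; apply: eq_bigr => j _.
  by rewrite expfzMl exprnP exprzAC -exprnP.
rewrite (sum_root_of_unity_pow (prim_rootV w_prim)).
case: ifP => [/dvdzP[b ->]|_]; last by rewrite mul0r rpred0.
by rewrite rpredM ?rpred_nat // mulrC -exprz_exp -exprnP tz rpredXz.
Qed.

End Laurent.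

(** * The state sum *)

Section StateSum.
Context (R : realType) (N k : nat) (k_gt0 : (0 < k)%N).
Local Notation C := (complex R).
Local Notation zeta := (zeta R k).
Context (Q : 'M[int]_N) (v : 'cV[int]_N) (z : 'I_N -> C).
Context (Q_sym : Q^T = Q) (z0 : forall i, z i != 0) (z1 : forall i, z i != 1).
Context (gluing_eq : forall i,
  (\prod_j z j ^ Q i j) * (1 - (z i)^-1) = (-1) ^ v i ord0).
Implicit Types (t : 'I_N -> C) (m : 'I_N -> nat).

Let h : C := expi (pi / k%:R).
Let z_prim : k.-primitive_root zeta := zeta_prim R k_gt0.

Lemma half_zeta : h ^+ 2 = zeta.
Proof. by rewrite -expiMn /Defs.zeta -mulrA mulr_natl. Qed.

Lemma half_zeta_neq0 : h != 0. Proof. exact: expi_neq0. Qed.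

Lemma half_zeta_exp : h ^+ k = -1.
Proof.
by rewrite -expiMn -[_ *+ k]mulr_natr divfK ?expi_pi // pnatr_eq0 -lt0n.
Qed.

Definition lin m j : int := \sum_l Q j l * (m l)%:Z.
Definition quad m : int := \sum_j (m j)%:Z * lin m j.
Definition lin_v m : int := \sum_j (m j)%:Z * v j 0.

Definition summand t m : C := (-1) ^ quad m * h ^ (quad m + lin_v m) *
  \prod_j (t j ^ (- lin m j) / qpoch (zeta / t j) zeta (m j)).

Definition state_sum t : C :=
  \sum_(m : {ffun 'I_N -> 'I_k}) summand t (fun j => m j).

(** The case n = 1 shifts the summation index, and n = k corrects its wrap-around. *)
Definition raise i n m : 'I_N -> nat := fun j => (m j + n * (j == i))%N.

Lemma sum_raise (x : 'I_N -> int) i n m :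
  \sum_j (raise i n m j)%:Z * x j = \sum_j (m j)%:Z * x j + n%:Z * x i.
Proof.
rewrite /raise; under eq_bigr do rewrite PoszD PoszM mulrDl.
rewrite big_split /=; congr (_ + _); rewrite (bigD1 i) //= eqxx mulr1.
by rewrite big1 ?addr0 // => j /negPf->; rewrite mulr0 mul0r.
Qed.

Lemma lin_raise i n m j : lin (raise i n m) j = lin m j + n%:Z * Q j i.
Proof.
rewrite /lin -[LHS]/(\sum_l Q j l * _).
under eq_bigr do rewrite mulrC.
by rewrite sum_raise; congr (_ + _); apply: eq_bigr => l _; rewrite mulrC.
Qed.

Lemma lin_v_raise i n m : lin_v (raise i n m) = lin_v m + n%:Z * v i 0.
Proof. exact: sum_raise. Qed.

Lemma quad_raise i n m :
  quad (raise i n m) = quad m + 2 * (n%:Z * lin m i) + n%:Z * n%:Z * Q i i.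
Proof.
rewrite {1}/quad; under eq_bigr do rewrite lin_raise.
rewrite sum_raise.
have -> : \sum_j (m j)%:Z * (lin m j + n%:Z * Q j i) = quad m + n%:Z * lin m i.
  under eq_bigr do rewrite mulrDr.
  rewrite big_split /= [lin m i]/lin big_distrr /=; congr (_ + _).
  by apply: eq_bigr => j _; rewrite -[in LHS]Q_sym mxE; ring.
ring.
Qed.

Lemma qpoch_recl (x y : C) n : qpoch x y n.+1 = (1 - x) * qpoch (y * x) y n.
Proof.
rewrite /qpoch big_nat_recl //= expr0 mul1r; congr (_ * _).
by apply: eq_bigr => r _; rewrite exprSr mulrA.
Qed.

Lemma signz_double (n : int) : (-1) ^ (2 * n) = 1 :> C.
Proof. by rewrite -exprz_exp -exprnP sqrrN expr1n exp1rz. Qed.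

Lemma signzD (a b : int) : (-1) ^ (a + b) = (-1) ^ a * (-1) ^ b :> C.
Proof. by rewrite expfzDr // oppr_eq0 oner_neq0. Qed.

Definition shift_factor i t : C := (-1) ^ Q i i * h ^ (- (Q i i + v i 0)) *
  \prod_j t j ^ Q j i * (1 - zeta / t i).

Lemma zeta_neq0 : zeta != 0.
Proof. exact: expi_neq0. Qed.

Lemma root_neq0 t i : kth_roots k z t -> t i != 0.
Proof. exact: (kth_roots_neq0 z_prim z0). Qed.

Lemma factor_neq0 t i r : kth_roots k z t -> 1 - zeta ^+ r / t i != 0.
Proof.
move=> tz; rewrite subr_eq0 eq_sym; apply: contra_neq (z1 i) => E.
have := congr1 (fun x => x ^+ k) E.
rewrite exprMn exprVn tz exprAC (prim_expr_order z_prim) !expr1n mul1r => /eqP.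
by rewrite invr_eq1 => /eqP.
Qed.

(** Rotating t_i moves the base point of its q-Pochhammer symbol by one step, which lengthens the
    symbol up to its first factor. The power of [zeta] coming from t_i matches the cross term of the
    quadratic form. *)
Lemma summand_shift i t m : kth_roots k z t ->
  summand (shift_root zeta i t) m = shift_factor i t * summand t (raise i 1 m).
Proof.
move=> tz; rewrite /summand /shift_factor.
have -> : \prod_j (shift_root zeta i t j ^ (- lin m j) /
      qpoch (zeta / shift_root zeta i t j) zeta (m j)) =
    \prod_j (t j ^ (- lin (raise i 1 m) j) / qpoch (zeta / t j) zeta (raise i 1 m j)) *
    \prod_j t j ^ Q j i * (zeta ^ lin m i * (1 - zeta / t i)).
  have tQ j : t j ^ (- Q j i) * t j ^ Q j i = 1.
    by rewrite -expfzDr ?root_neq0 // addNr expr0z.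
  rewrite [RHS]mulrC -big_split /= (bigD1 i) //= [in RHS](bigD1 i) //= mulrA.
  congr (_ * _).
    rewrite lin_raise mul1r /raise eqxx muln1 addn1 qpoch_recl /shift_root eqxx.
    rewrite opprD expfzDr ?root_neq0 // expfzMl invfM invrK.
    have x0 : 1 - zeta / t i != 0 by apply: (factor_neq0 i 1).
    rewrite exprz_inv opprK invfM; set x := 1 - _ in x0 *.
    have cancel (F : comNzRingType) (a b c d d' e e' : F) : d * d' = 1 -> e' * e = 1 ->
        a * b * c = a * d * (b * e' * (d' * c) * e).
      move=> dd ee; transitivity (a * b * c * (d * d') * (e' * e)); last by ring.
      by rewrite dd ee !mulr1.
    exact: cancel (divff x0) (tQ i).
  apply: eq_bigr => j ji; rewrite lin_raise mul1r /raise (negPf ji) muln0 addn0.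
  rewrite /shift_root (negPf ji) opprD expfzDr ?root_neq0 //.
  have cancel (F : comNzRingType) (a c e e' : F) : e' * e = 1 ->
      a * c = a * e' * c * e.
    by move=> ee; transitivity (a * c * (e' * e)); [rewrite ee mulr1 | ring].
  exact: cancel (tQ j).
rewrite quad_raise lin_v_raise !mul1r.
set q := Q i i; set l := lin m i; set b := lin_v m; set a := quad m.
have -> : h ^ (a + 2 * l + q + (b + v i 0)) = h ^ (a + b) * zeta ^ l * h ^ (q + v i 0).
  rewrite -half_zeta [in RHS]exprnP exprz_exp -!expfzDr ?half_zeta_neq0 //.
  by congr (h ^ _); ring.
have hh : h ^ (- (q + v i 0)) * h ^ (q + v i 0) = 1.
  by rewrite -expfzDr ?half_zeta_neq0 // addNr expr0z.
have qq : (-1) ^ q * (-1) ^ q = 1 :> C.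
  by rewrite -signzD -(mulr2n q) -mulr_natl signz_double.
have -> : (-1) ^ (a + 2 * l + q) = (-1) ^ a * (-1) ^ q :> C.
  by rewrite !signzD signz_double mulr1.
have cancel (F : comNzRingType) (s s' c d d' e f g x : F) :
    d' * d = 1 -> s' * s' = 1 ->
    s * c * (e * f * (g * x)) = s' * d' * f * x * (s * s' * (c * g * d) * e).
  move=> dd ss; transitivity (s * c * (e * f * (g * x)) * (d' * d) * (s' * s')).
    by rewrite dd ss !mulr1.
  ring.
exact: cancel hh qq.
Qed.

(** A full q-Pochhammer symbol is 1 - 1/z_i, and the k-th powers of the t_j are the z_j; the gluing
    equation turns both into a sign, which cancels the one from [h ^+ k = -1]. *)
Lemma summand_period i t m : kth_roots k z t -> m i = 0%N ->
  summand t (raise i k m) = summand t m.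
Proof.
move=> tz mi; rewrite /summand quad_raise lin_v_raise.
have -> : \prod_j (t j ^ (- lin (raise i k m) j) /
      qpoch (zeta / t j) zeta (raise i k m j)) =
    \prod_j (t j ^ (- lin m j) / qpoch (zeta / t j) zeta (m j)) *
    (\prod_j z j ^ (- Q j i) / (1 - (z i)^-1)).
  have -> : (1 - (z i)^-1)^-1 = \prod_j (if j == i then (1 - (z i)^-1)^-1 else 1).
    by rewrite (bigD1 i) //= eqxx big1 ?mulr1 // => j /negPf->.
  rewrite -!big_split /=; apply: eq_bigr => j _.
  rewrite lin_raise opprD expfzDr ?root_neq0 //.
  have -> : t j ^ (- (k%:Z * Q j i)) = z j ^ (- Q j i).
    by rewrite -tz exprnP exprz_exp mulrN.
  rewrite /raise; case: eqP => [->|_]; last by rewrite muln0 addn0 mulr1 mulrAC.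
  rewrite mi muln1 add0n.
  have -> : qpoch (zeta / t i) zeta k = 1 - (z i)^-1.
    rewrite /qpoch (prod_root_of_unity z_prim).
    by rewrite exprMn exprVn tz (prim_expr_order z_prim) mul1r.
  by rewrite /qpoch big_geq // invr1 mulr1 mulrA.
have zQ : \prod_j z j ^ (- Q j i) / (1 - (z i)^-1) = (-1) ^ (- v i 0).
  have zzE : (1 - (z i)^-1) != 0 by rewrite subr_eq0 eq_sym invr_eq1.
  rewrite -[RHS]invr_expz -gluing_eq invfM -prodfV; congr (_ / _).
  by apply: eq_bigr => j _; rewrite invr_expz -[in LHS]Q_sym mxE.
rewrite {}zQ.
set q := Q i i; set l := lin m i; set b := lin_v m; set a := quad m.
have -> : h ^ (a + 2 * (k%:Z * l) + k%:Z * k%:Z * q + (b + k%:Z * v i 0)) =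
    h ^ (a + b) * (-1) ^ (2 * l + k%:Z * q + v i 0).
  rewrite -half_zeta_exp exprnP exprz_exp -expfzDr ?half_zeta_neq0 //.
  by congr (h ^ _); ring.
(* The exponents add up to k (k + 1) q, which is even. *)
have kq : (-1) ^ (k%:Z * k%:Z * q) * (-1) ^ (k%:Z * q) = 1 :> C.
  rewrite -signzD; have /dvdzP[n E] := dvdz_pronic k%:Z.
  by rewrite -mulrDl -[X in _ + X]mulr1 -mulrDr E mulrAC mulrC signz_double.
have vv : (-1) ^ (v i 0) * (-1) ^ (- v i 0) = 1 :> C by rewrite -signzD subrr expr0z.
rewrite (signzD (a + _)) (signzD a) signz_double mulr1.
rewrite (signzD (2 * l + _)) (signzD (2 * l)) signz_double mul1r.
have cancel (F : comNzRingType) (s s1 s2 s3 s4 c e : F) : s1 * s2 = 1 -> s3 * s4 = 1 ->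
    s * s1 * (c * (s2 * s3)) * (e * s4) = s * c * e.
  move=> s12 s34; transitivity (s * c * e * (s1 * s2) * (s3 * s4)); first by ring.
  by rewrite s12 s34 !mulr1.
exact: cancel kq vv.
Qed.

Lemma state_sum_shift i t : kth_roots k z t ->
  state_sum (shift_root zeta i t) = shift_factor i t * state_sum t.
Proof.
move=> tz; rewrite /state_sum big_distrr /=.
pose f (m : {ffun 'I_N -> 'I_k}) := [ffun j => if j == i then ordS (m j) else m j].
have f_inj : injective f.
  move=> m m' /ffunP E; apply/ffunP => j; have := E j; rewrite !ffunE.
  by case: ifP => // _ /ordS_inj.
rewrite [RHS](reindex_inj f_inj) /=; apply: eq_bigr => m _.
rewrite summand_shift //; congr (_ * _).
have [mk|mk] := ltnP (m i).+1 k.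
  congr summand; apply/boolp.funext => j; rewrite /raise ffunE mul1n.
  by case: eqP => [->|_]; rewrite ?addn0 //= modn_small // addn1.
(* Here [m i] is k - 1: the cyclic successor is 0, and periodicity identifies the index k with
   it. *)
have {}mk : (m i).+1 = k by apply/eqP; rewrite eqn_leq ltn_ord mk.
rewrite -(@summand_period i _ (fun j => f m j)) //; last first.
  by rewrite ffunE eqxx /= mk modnn.
congr summand; apply/boolp.funext => j; rewrite /raise ffunE mul1n.
by case: eqP => [->|_]; rewrite ?muln0 ?addn0 //= mk modnn muln1 addn1.
Qed.

(** The substitution shifts each factor by one place, so every exponent grows by one; the extra copy
    of all factors multiplies to 1 - x^k. *)
Lemma Dstar_shift (x : C) :
  Dstar k (zeta * x) * (1 - zeta * x) ^+ k = Dstar k x * (1 - x ^+ k).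
Proof.
pose g s := 1 - zeta ^- s * x.
have gS s : 1 - zeta ^- s.+1 * (zeta * x) = g s.
  by rewrite /g exprSr invfM -mulrA mulKf ?zeta_neq0.
have gk : 1 - zeta * x = g k.-1.
  rewrite /g -[X in X * x](mulKf (expf_neq0 k.-1 zeta_neq0)) -exprSr prednK //.
  by rewrite (prim_expr_order z_prim) mulr1.
have -> : Dstar k x = \prod_(0 <= s < k) g s ^+ s by rewrite big_ltn // expr0 mul1r.
rewrite -(prod_root_of_unity (prim_rootV z_prim)) -big_split /=.
under [RHS]eq_bigr do rewrite exprVn -/(g _) -exprSr.
rewrite -[in RHS](prednK k_gt0) big_nat_recr //= prednK // gk; congr (_ * _).
by rewrite /Dstar big_add1; apply: eq_bigr => s _; rewrite gS.
Qed.

(** For the matrices of the datum, this is [tau ^+ (2 * k)] up to a factor in F_k. *)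
Definition invariant_product t : C :=
  (\prod_i Dstar k (t i)^-1) ^+ 2 * state_sum t ^+ (2 * k).

Lemma invariant_product_shift i t : kth_roots k z t ->
  invariant_product (shift_root zeta i t) = invariant_product t.
Proof.
move=> tz; rewrite /invariant_product state_sum_shift // exprMn mulrA.
congr (_ * _).
have D_shift : (\prod_j Dstar k (shift_root zeta i t j)^-1) * (1 - zeta / t i) ^+ k =
    (\prod_j Dstar k (t j)^-1) * (1 - (z i)^-1).
  rewrite (bigD1 i) //= [in RHS](bigD1 i) //= mulrAC [RHS]mulrAC; congr (_ * _); last first.
    by apply: eq_bigr => j /negPf ji; rewrite /shift_root ji.
  by rewrite /shift_root eqxx invfM invrK Dstar_shift exprVn tz.
(* Written as a square, the product only needs its root to be controlled up to sign. *)
rewrite mulnC exprM -exprMn.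
have -> : shift_factor i t ^+ k = (-1) ^ (k%:Z * Q i i - (Q i i + v i 0)) *
    (\prod_j z j ^ Q i j * (1 - zeta / t i) ^+ k).
  rewrite /shift_factor !exprMn mulrA; congr (_ * _); rewrite signzD.
  congr (_ * _); first congr (_ * _).
  - by rewrite exprnP exprz_exp mulrC.
  - by rewrite exprnP exprzAC -exprnP half_zeta_exp.
  rewrite -prodrXl; apply: eq_bigr => j _.
  by rewrite -tz !exprnP exprzAC -[in RHS]Q_sym mxE.
rewrite mulrCA [X in _ * X]mulrCA D_shift.
rewrite [X in _ * X]mulrCA gluing_eq.
by rewrite !exprMn !exprnP !exprz_exp ![_ * 2%:Z]mulrC !signz_double ?mul1r mulr1.
Qed.

Lemma laurent_invariant_product (K : divringClosed C) :
  zeta \in K -> (forall i, z i \in K) -> (forall m, (2 %| quad m + lin_v m)%Z) ->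
  laurent K k z invariant_product.
Proof.
move=> zetaK zK quad_even; apply: (laurentM z_prim z0); apply: (laurentX z_prim z0).
  apply: (laurent_prod z_prim z0) => i _; apply: (laurent_prod z_prim z0) => s _.
  apply: (laurentX z_prim z0); apply: (laurent_factor z_prim z0).
  by rewrite rpredV rpredX.
apply: laurent_sum => m _; apply: (laurentM z_prim z0).
  (* By evenness, this power of [h] is a power of [zeta]. *)
  apply: laurent_const; have /dvdzP[n ->] := quad_even (fun j => m j).
  rewrite [n * 2]mulrC -exprz_exp -exprnP half_zeta.
  by rewrite rpredM // rpredXz ?rpredN ?rpred1.
apply: (laurent_prod z_prim z0) => i _; apply: (laurentM z_prim z0).
  exact: laurent_exp.
have L : laurent K k z (fun t => \prod_(0 <= r < m i) (1 - zeta ^+ r.+1 / t i)^-1).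
  by apply: (laurent_prod z_prim z0) => r _; apply: (laurent_factorV z_prim).
apply: eq_laurent L => t tz; rewrite /qpoch prodfV; congr (_^-1).
by apply: eq_bigr => r _; rewrite exprSr mulrA.
Qed.

End StateSum.

(** * The 1-loop invariant *)

Section OneLoopInvariant.
Context (R : realType) (N : nat) (gam : NZ_tuple R N).
Local Notation C := (complex R).
Local Notation A := (nzA gam).
Local Notation B := (nzB gam).
Local Notation Q := (invmx (nzB gam) *m nzA gam).
Local Notation v := (invmx (nzB gam) *m nz_nu gam).

Lemma linE (M : 'M[int]_N) (m : 'I_N -> nat) j :
  (M *m (\col_i (m i)%:Z)) j 0 = lin M m j.
Proof. by rewrite mxE; apply: eq_bigr => i _; rewrite mxE. Qed.

Lemma quadE (M : 'M[int]_N) (m : 'I_N -> nat) :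
  ((\col_i (m i)%:Z)^T *m (M *m (\col_i (m i)%:Z))) 0 0 = quad M m.
Proof. by rewrite mxE; apply: eq_bigr => i _; rewrite linE !mxE. Qed.

Lemma lin_vE (u : 'cV[int]_N) (m : 'I_N -> nat) :
  ((\col_i (m i)%:Z)^T *m u) 0 0 = lin_v u m.
Proof. by rewrite mxE; apply: eq_bigr => i _; rewrite !mxE. Qed.

Lemma a_coefE k theta m : a_coef gam k theta m = summand k Q v theta m.
Proof.
rewrite /a_coef quadE lin_vE expi_int_pi /summand; congr (_ * _).
by apply: eq_bigr => i _; rewrite linE.
Qed.

(** The gluing equations are combined multiplicatively with the exponents in row i of [invmx B],
    which isolates z''_i. *)
Lemma gluing_eq_inv : B \in unitmx ->
  (forall i, nz_z gam i != 0 /\ nz_z gam i != 1) ->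
  (forall j, \prod_i (nz_z gam i ^ A j i * nz_z'' gam i ^ B j i) =
             (-1) ^ nz_nu gam j 0) ->
  forall i, (\prod_j nz_z gam j ^ Q i j) * (1 - (nz_z gam i)^-1) = (-1) ^ v i 0.
Proof.
move=> B_unit z01 eqs l.
have pow0 (x : C) (I : finType) (f : I -> int) : x != 0 ->
    x ^ (\sum_i f i) = \prod_i x ^ f i.
  by move=> x0; apply: (big_morph _ _ (expr0z x)) => a b; rewrite expfzDr.
have z''0 i : nz_z'' gam i != 0.
  by have [_ z1] := z01 i; rewrite /nz_z'' subr_eq0 eq_sym invr_eq1.
rewrite [v l 0]mxE pow0 ?oppr_eq0 ?oner_neq0 //.
under [RHS]eq_bigr do rewrite mulrC -exprz_exp -eqs.
have prodXz (I : finType) (f : I -> C) n : (\prod_i f i) ^ n = \prod_i f i ^ n.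
  by apply: (big_morph (fun x : C => x ^ n)) => [x y|]; rewrite ?exp1rz ?expfzMl.
under [RHS]eq_bigr do rewrite prodXz.
rewrite exchange_big /=.
have -> : 1 - (nz_z gam l)^-1 = \prod_i nz_z'' gam i ^ (1%:M : 'M[int]_N) l i.
  rewrite (bigD1 l) //= mxE eqxx expr1z big1 ?mulr1 // => i il.
  by rewrite mxE eq_sym (negPf il) expr0z.
rewrite -(mulVmx B_unit) -big_split /=; apply: eq_bigr => i _.
rewrite !mxE !pow0 //; last by have [] := z01 i.
rewrite -big_split /=; apply: eq_bigr => j _.
by rewrite expfzMl !exprz_exp ![_ * invmx _ _ _]mulrC.
Qed.

End OneLoopInvariant.

Theorem theorem2p2 (R : realType) (N : nat) (T : gluing N) (gam : NZ_tuple R N)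
    (k : nat) (theta : 'I_N -> complex R) (tau : complex R)
    (hT : one_cusped_triangulation T)
    (hgam : NZ_datum T gam)
    (hB : Z_nondegenerate gam)
    (hk : (0 < k)%N)
    (htheta : forall i, theta i ^+ k = nz_z gam i)
    (hdet : one_loop_det gam != 0)
    (htau : one_loop_value gam k theta tau) :
  F_field gam k (tau ^+ (2 * k)).
Proof.
move=> K0 K0_closed K0_gen.
pose K : divringClosed (complex R) :=
  HB.pack K0 (GRing.isDivringClosed.Build (complex R) K0 K0_closed).
rewrite -[K0]/(K : {pred _}).
have zetaK : zeta R k \in K by apply: K0_gen; left.
have zK i : nz_z gam i \in K by apply: K0_gen; right; exists i.
have [T_or _ _ _] := hT.
have [q [AB z01 _ eqs _]] := hgam.
have AB_sym := gluing_matrices_sym T_or AB.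
have Q_sym := quad_sym hB AB_sym.
have z0 i : nz_z gam i != 0 by have [] := z01 i.
have z1 i : nz_z gam i != 1 by have [] := z01 i.
have z''K i : nz_z'' gam i \in K by rewrite rpredB ?rpred1 ?rpredV.
have detK : one_loop_det gam \in K.
  apply: rpred_sum => s _; rewrite rpredM ?rpredX ?rpredN ?rpred1 //.
  apply: rpred_prod => i _; rewrite !mul_mx_diag mxE rpredD //.
    by rewrite !mxE rpredM ?rpred_int.
  by rewrite !mxE rpredM ?rpred_int ?rpredV.
have PK : invariant_product k (invmx (nzB gam) *m nzA gam)
    (invmx (nzB gam) *m nz_nu gam) theta \in K.
  apply: (laurent_invariant (zeta_prim R hk) zK).
  - apply: (laurent_invariant_product hk z0 z1) => // m.
    rewrite -quadE -lin_vE; apply: (quad_even hB AB_sym).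
    exact: (gluing_matrices_parity T_or AB).
  - move=> u i uz; apply: (invariant_product_shift hk Q_sym z0 z1) => //.
    exact: gluing_eq_inv.
  - exact: htheta.
  - by rewrite pnatr_eq0 -lt0n.
have [s [u [u'' [d [uE u''E dE sE ->]]]]] := htau.
have -> : \sum_(m : {ffun 'I_N -> 'I_k}) a_coef gam k theta (fun i => m i) =
    state_sum k (invmx (nzB gam) *m nzA gam) (invmx (nzB gam) *m nz_nu gam) theta.
  by apply: eq_bigr => m _; rewrite a_coefE.
rewrite !exprMn.
(* All choices of roots disappear in the power 2k: the [d i] give squares of dilogarithms, the root
   of k gives a power of k, and [s] gives the determinant with integral powers of z and z''. *)
have dK : (\prod_i d i) ^+ (2 * k) = (\prod_i Dstar k (theta i)^-1) ^+ 2.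
  by rewrite mulnC exprM -prodrXl; under eq_bigr do rewrite dE.
rewrite dK -mulrA rpredM // exprVn rpredV exprMn rpredM //.
  by rewrite -exprM mulnCA exprM sqrtCK rpredX ?rpred_nat.
rewrite exprM sE exprMn rpredM //; first exact: rpredX.
rewrite -prodrXl; apply: rpred_prod => i _.
by rewrite exprMn uE u''E rpredM // rpredXz.
Qed.
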